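(* Let $A=A^T\succ0$ in $\mathbb R^{n\times n}$ and $b\in\mathbb R^n$, $b\neq 0$, have floating-point entries with $\frac12\le\|A\|_2\le1$ and $\frac12\le\|b\|_2\le1$, let $x_0$ be a floating-point vector, and let $0<\varepsilon\le1$. Let scalar rounding satisfy $|\operatorname{fl}(z)-z|\le u|z|$ (i.e. $\omega=0$ in the model $|\operatorname{fl}(z)-z|\le u|z|+\omega$), suppose the exponent range is unbounded, and suppose the range assumption in the context holds. With the constants defined in the context, put $$p_{\rm suff}=\left\lceil\max\left\{\log_2\frac{2}{\delta}+N\log_2C,\ \log_2\frac{1024(V+1)^2C_{\rm s}^{N_{\rm s}}}{\varepsilon_0^2}\right\}\right\rceil .$$ If $u=2^{-p}$ and $p\ge p_{\rm suff}$, then $$2uC^N\le\delta\qquad\text{and}\qquad E_{\rm s}\le\frac{\varepsilon_0^2}{256}.$$ Consequently, the CG algorithm with true-residual stopping test described in the context stops at an index $i_*\le n$ and returns a nonzero vector $\widehat x_{i_*}$ satisfying $$\eta(\widehat x_{i_*})\le\eta_A(\widehat x_{i_*})\le\varepsilon_0\le\varepsilon .$$ When $x_0=0$, $$p_{\rm suff}=O\!\left(n^3\log\left(2+\frac{n\,\kappa_2(A)}{\varepsilon}\right)\right).$$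
   Context: Backward errors: $\eta(x)=\dfrac{\|b-Ax\|_2}{\|A\|_2\|x\|_2+\|b\|_2}$, and for $x\ne0$, $\eta_A(x)=\dfrac{\|b-Ax\|_2}{\|A\|_2\|x\|_2}$. $\kappa_2(A)=\|A\|_2\|A^{-1}\|_2$. The constant in $O(\cdot)$ is absolute. Constants (with $\omega=0$): $$\chi=\max\left\{1,\frac{\|b-Ax_0\|_2}{\|b\|_2}\right\},\quad \varepsilon_0=2^{\lfloor\log_2\varepsilon\rfloor},\quad d=\frac{\varepsilon_0^2}{200\,\kappa_2(A)},\quad G=\kappa_2(A),\quad P=\kappa_2(A)\chi,$$ $$U=2+d^{-1}+\kappa_2(A)\chi^2+2\kappa_2(A)(1+\chi)+P^2+(2\kappa_2(A)+G+2)P,$$ $$C=\frac{8U^2}{d^2},\qquad N=2n^3+13n^2-n,\qquad \delta=\min\left\{1,\frac d2,\frac{\varepsilon_0}{20\sqrt n}\right\},$$ $$X=2\kappa_2(A)(1+\chi)+1,\quad V=4(2+X)^2,\quad C_{\rm s}=8V^2,\quad N_{\rm s}=2n^2+4n+2,$$ $$\rho_{\rm s}=2u(V+1)^2+\omega,\qquad E_{\rm s}=2\rho_{\rm s}C_{\rm s}^{N_{\rm s}},$$ $$H=\max\left\{2(U+1),\ (U+1)^2+(U+1),\ \frac{2(U+1)}{d},\ 2(V+1)^2\right\}.$$ Arithmetic: $p$ is the number of significand bits, $u=2^{-p}$ the unit roundoff, $\operatorname{fl}$ is scalar round-to-nearest. Every dense matrix row and inner product is accumulated from left to right. Products and partial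 sums are stored separately. In an AXPY (vector update $y+\alpha x$), each product is rounded before the addition, and each quotient is formed by one division. A stored squared residual norm may be reused. A fused multiply-add may replace one product-add pair by its correctly rounded result. Algorithm (Hestenes--Stiefel CG with a true-residual stopping test): set $r_0=\operatorname{fl}(b-Ax_0)$, $p_0=r_0$. For $i=0,1,\dots$: (1) evaluate in floating point, directly from the stored iterate $\widehat x_i$ (the stored $x_i$) and without modifying the CG state, a stored value $\widehat\Phi_i$ of $\Phi(\widehat x_i)=\|b-A\widehat x_i\|_2^2-\frac{\varepsilon_0^2}{4}\|\widehat x_i\|_2^2$ (the residual is recomputed, the two squared norms are formed, the second is scaled and subtracted); (2) if $\widehat\Phi_i\le-\varepsilon_0^2/256$, return $\widehat x_i$ (the stopping test succeeds); (3) if $r_i=0$, terminate with a zero stored residual; (4) otherwise compute $$q_i=\operatorname{fl}(Ap_i),\quad a_i^{\rm cg}=\operatorname{fl}\!\left(\frac{\operatorname{fl}(\langle r_i,r_i\rangle)}{\operatorname{fl}(\langle q_i,p_i\rangle)}\right),\quad x_{i+1}=\operatorname{fl}(x_i+a_i^{\rm cg}p_i),\quad r_{i+1}=\operatorname{fl}(r_i-a_i^{\rm cg}q_i),$$ $$b_{i+1}^{\rm cg}=\operatorname{fl}\!\left(\frac{\operatorname{fl}(\langle r_{i+1},r_{i+1}\rangle)}{\operatorname{fl}(\langle r_i,r_i\rangle)}\right),\quad p_{i+1}=\operatorname{fl}(r_{i+1}+b_{i+1}^{\rm cg}p_i).$$ Range assumption: the quantities $\varepsilon_0$, $\varepsilon_0^2/4$,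 $\varepsilon_0^2/256$ are represented exactly; $A$, $b$, $x_0$ are stored floating-point values; every exact scalar result of the algorithm and its stopping test that has magnitude at most $H$ lies in the exponent range, so that the rounding bound applies without overflow. *)

(* Defs.v *)
From HB Require Import structures.
From mathcomp Require Export all_boot all_order all_algebra.
From mathcomp Require Export all_classical all_reals all_analysis.
Set Implicit Arguments.
Unset Strict Implicit.
Unset Printing Implicit Defensive.
Export Order.TTheory GRing.Theory Num.Theory.
Export numFieldNormedType.Exports.
Local Open Scope classical_set_scope.
Local Open Scope ring_scope.

Definition log2 (R : realType) (x : R) : R := ln x / ln 2.

Definition norm2 (R : realType) (n : nat) (x : 'cV[R]_n) : R :=
  Num.sqrt (\sum_(i < n) x i 0 ^+ 2).

Definition opnorm2 (R : realType) (n : nat) (A : 'M[R]_n) : R :=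
  sup [set norm2 (A *m x) / norm2 x | x in [set x : 'cV[R]_n | x != 0]].

Definition kappa2 (R : realType) (n : nat) (A : 'M[R]_n) : R :=
  opnorm2 A * opnorm2 (invmx A).

Definition posdefmx (R : realType) (n : nat) (A : 'M[R]_n) : Prop :=
  forall x : 'cV[R]_n, x != 0 -> 0 < (x^T *m A *m x) 0 0.

Definition eta (R : realType) (n : nat) (A : 'M[R]_n) (b x : 'cV[R]_n) : R :=
  norm2 (b - A *m x) / (opnorm2 A * norm2 x + norm2 b).

(* Only meaningful for x != 0. *)
Definition eta_A (R : realType) (n : nat) (A : 'M[R]_n) (b x : 'cV[R]_n) : R :=
  norm2 (b - A *m x) / (opnorm2 A * norm2 x).

Definition eps0 (R : realType) (eps : R) : R := 2 ^ Num.floor (log2 eps).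

Section Constants.
Context (R : realType) (n : nat) (A : 'M[R]_n) (b x0 : 'cV[R]_n) (eps : R).

Definition cst_chi : R := Num.max 1 (norm2 (b - A *m x0) / norm2 b).
Definition cst_d : R := eps0 eps ^+ 2 / (200 * kappa2 A).
Definition cst_G : R := kappa2 A.
Definition cst_P : R := kappa2 A * cst_chi.
Definition cst_U : R :=
  2 + cst_d^-1 + kappa2 A * cst_chi ^+ 2 + 2 * kappa2 A * (1 + cst_chi)
  + cst_P ^+ 2 + (2 * kappa2 A + cst_G + 2) * cst_P.
Definition cst_C : R := 8 * cst_U ^+ 2 / cst_d ^+ 2.
Definition cst_N : nat := 2 * n ^ 3 + 13 * n ^ 2 - n.
Definition cst_delta : R :=
  Num.min 1 (Num.min (cst_d / 2) (eps0 eps / (20 * Num.sqrt n%:R))).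

Definition cst_X : R := 2 * kappa2 A * (1 + cst_chi) + 1.
Definition cst_V : R := 4 * (2 + cst_X) ^+ 2.
Definition cst_Cs : R := 8 * cst_V ^+ 2.
Definition cst_Ns : nat := 2 * n ^ 2 + 4 * n + 2.
Definition cst_rhos (u omega : R) : R := 2 * u * (cst_V + 1) ^+ 2 + omega.
Definition cst_Es (u omega : R) : R := 2 * cst_rhos u omega * cst_Cs ^+ cst_Ns.

Definition cst_H : R :=
  Num.max (2 * (cst_U + 1))
    (Num.max ((cst_U + 1) ^+ 2 + (cst_U + 1))
      (Num.max (2 * (cst_U + 1) / cst_d) (2 * (cst_V + 1) ^+ 2))).

Definition p_suff : int :=
  Num.ceil (Num.max
    (log2 (2 / cst_delta) + cst_N%:R * log2 cst_C)
    (log2 (1024 * (cst_V + 1) ^+ 2 * cst_Cs ^+ cst_Ns / eps0 eps ^+ 2))).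

End Constants.

Section FloatingPoint.
Context (R : realType).

Definition unit_roundoff (p : nat) : R := 2 ^- p.

(* Binary floating-point numbers with p significand bits (m is the integer
   significand) and exponents in E, where the exponent of x <> 0 is the integer
   e such that 2 ^ e <= `|x| < 2 ^ (e + 1). *)
Definition is_float (E : set int) (p : nat) (x : R) : Prop :=
  x = 0 \/
  exists m e : int, [/\ E e, 2 ^+ p.-1 <= `|m|, `|m| < 2 ^+ p &
                        x = m%:~R * 2 ^ (e - p%:Z + 1)].

Definition in_range (E : set int) (z : R) : Prop :=
  z = 0 \/ exists e : int, [/\ E e, 2 ^ e <= `|z| & `|z| < 2 ^ (e + 1)].

(* Ties may be broken in any way. *)
Definition round_to_nearest (E : set int) (p : nat) (fl : R -> R) : Prop :=
  forall z, in_range E z ->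
    is_float E p (fl z) /\
    forall w, is_float E p w -> `|fl z - z| <= `|w - z|.

Definition rounding_model (E : set int) (u omega : R) (fl : R -> R) : Prop :=
  forall z, in_range E z -> `|fl z - z| <= u * `|z| + omega.

Definition unbounded_exponents (E : set int) : Prop := forall e, E e.

(* The last clause asks for every real of magnitude at most H, rather than only
   for the exact scalar results of the algorithm; it holds automatically for
   unbounded exponents. *)
Definition range_assumption (E : set int) (p n : nat)
    (A : 'M[R]_n) (b x0 : 'cV[R]_n) (eps : R) : Prop :=
  [/\ [/\ is_float E p (eps0 eps), is_float E p (eps0 eps ^+ 2 / 4) &
          is_float E p (eps0 eps ^+ 2 / 256)],
      forall i j, is_float E p (A i j),
      forall i, is_float E p (b i 0),
      forall i, is_float E p (x0 i 0) &
      forall z, `|z| <= cst_H A b x0 eps -> in_range E z].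

End FloatingPoint.

(* Floating-point evaluation is a relation between operands and possible stored
   results, since each product-add pair may or may not be fused. *)
Section Evaluation.
Context (R : realType) (fl : R -> R).

Definition fl_muladd (s a c v : R) : Prop :=
  v = fl (s + fl (a * c)) \/ v = fl (s + a * c).

Definition fl_mulsub (s a c v : R) : Prop :=
  v = fl (s - fl (a * c)) \/ v = fl (s - a * c).

Fixpoint fl_accum (s : R) (l : seq (R * R)) (v : R) : Prop :=
  if l is (a, c) :: l' then exists2 s', fl_muladd s a c s' & fl_accum s' l' v
  else v = s.

(* Left-to-right inner product; the accumulation starts with the first rounded
   product. *)
Definition fl_dot (n : nat) (f g : 'I_n -> R) (v : R) : Prop :=
  if [seq (f i, g i) | i <- enum 'I_n] is (a, c) :: l
  then fl_accum (fl (a * c)) l v else v = 0.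

Definition fl_sqnorm (n : nat) (x : 'cV[R]_n) (v : R) : Prop :=
  fl_dot (x^~ 0) (x^~ 0) v.

Definition fl_matvec (n : nat) (A : 'M[R]_n) (x y : 'cV[R]_n) : Prop :=
  forall i, fl_dot (A i) (x^~ 0) (y i 0).

Definition fl_residual (n : nat) (A : 'M[R]_n) (b x r : 'cV[R]_n) : Prop :=
  exists2 y, fl_matvec A x y & forall i, r i 0 = fl (b i 0 - y i 0).

Definition fl_axpy (n : nat) (y : 'cV[R]_n) (a : R) (x z : 'cV[R]_n) : Prop :=
  forall i, fl_muladd (y i 0) a (x i 0) (z i 0).

Definition fl_axmy (n : nat) (y : 'cV[R]_n) (a : R) (x z : 'cV[R]_n) : Prop :=
  forall i, fl_mulsub (y i 0) a (x i 0) (z i 0).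

(* Stored values of |b - A x|^2 - (e0^2 / 4) |x|^2. *)
Definition fl_Phi (n : nat) (A : 'M[R]_n) (b : 'cV[R]_n) (e0 : R)
    (x : 'cV[R]_n) (v : R) : Prop :=
  exists r rr xx, [/\ fl_residual A b x r, fl_sqnorm r rr, fl_sqnorm x xx &
                      fl_mulsub rr (e0 ^+ 2 / 4) xx v].

End Evaluation.

(* Between two iterations the algorithm is in a state CGRun x r p; CGBreakdown
   is a division by a zero denominator. *)
Inductive cg_state (R : realType) (n : nat) : Type :=
| CGRun of 'cV[R]_n & 'cV[R]_n & 'cV[R]_n
| CGReturn of 'cV[R]_n
| CGZeroResidual
| CGBreakdown.

Arguments CGRun {R n}.
Arguments CGReturn {R n}.
Arguments CGZeroResidual {R n}.
Arguments CGBreakdown {R n}.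

(* The occurrences of fl(<r, r>) are evaluated independently, which covers
   both recomputing a squared residual norm and reusing a stored one. *)
Inductive cg_step (R : realType) (fl : R -> R) (n : nat) (A : 'M[R]_n)
    (b : 'cV[R]_n) (e0 : R) : cg_state R n -> cg_state R n -> Prop :=
| cg_stop x r p Phi :
    fl_Phi fl A b e0 x Phi -> Phi <= - (e0 ^+ 2 / 256) ->
    cg_step fl A b e0 (CGRun x r p) (CGReturn x)
| cg_zero_residual x r p Phi :
    fl_Phi fl A b e0 x Phi -> - (e0 ^+ 2 / 256) < Phi -> r = 0 ->
    cg_step fl A b e0 (CGRun x r p) CGZeroResidual
| cg_breakdown x r p Phi q qp rr :
    fl_Phi fl A b e0 x Phi -> - (e0 ^+ 2 / 256) < Phi -> r <> 0 ->
    fl_matvec fl A p q -> fl_dot fl (q^~ 0) (p^~ 0) qp -> fl_sqnorm fl r rr ->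
    qp = 0 \/ rr = 0 ->
    cg_step fl A b e0 (CGRun x r p) CGBreakdown
| cg_iterate x r p Phi q qp rr rr' x1 r1 rr1 p1 :
    fl_Phi fl A b e0 x Phi -> - (e0 ^+ 2 / 256) < Phi -> r <> 0 ->
    fl_matvec fl A p q ->
    fl_sqnorm fl r rr -> fl_dot fl (q^~ 0) (p^~ 0) qp -> qp <> 0 ->
    fl_axpy fl x (fl (rr / qp)) p x1 ->
    fl_axmy fl r (fl (rr / qp)) q r1 ->
    fl_sqnorm fl r1 rr1 -> fl_sqnorm fl r rr' -> rr' <> 0 ->
    fl_axpy fl r1 (fl (rr1 / rr')) p p1 ->
    cg_step fl A b e0 (CGRun x r p) (CGRun x1 r1 p1).

(* s i is the state at the start of iteration i; a terminal state is repeated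
   forever. *)
Definition cg_execution (R : realType) (fl : R -> R) (n : nat) (A : 'M[R]_n)
    (b x0 : 'cV[R]_n) (e0 : R) (s : nat -> cg_state R n) : Prop :=
  (exists2 r0, fl_residual fl A b x0 r0 & s 0%N = CGRun x0 r0 r0) /\
  forall i, if s i is CGRun _ _ _ then cg_step fl A b e0 (s i) (s i.+1)
            else s i.+1 = s i.

(* Main.v *)
(* The computed iterates are compared with those of exact conjugate gradients.
   In exact arithmetic the residuals are mutually orthogonal, so r_n = 0, and
   the A-norm of the error decreases, so all quantities are at most U - 2.  As
   long as the test has not succeeded, |r_k|^2 >= e0^2 / 100, hence the
   denominators <r_k, r_k> and <p_k, A p_k> are at least d.  Each elementary
   operation (dot product, quotient, vector update) then multiplies the
   componentwise distance between computed and exact quantities by at most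
   Q = 64^n U^2, and an iteration consists of seven consecutive ones.  After n
   iterations and a test the distance is at most Q^(7n+7) u <= C^N u <= d / 4,
   which is below the margins of the test and of the denominators.  So there is
   no breakdown, and a run without a successful test at indices 0, ..., n would
   give |r_n| > 0. *)
Require Import Defs.
From mathcomp Require Import all_boot all_order all_algebra.
From mathcomp Require Import all_classical all_reals all_analysis.
From mathcomp Require Import ring lra zify.
Set Implicit Arguments.
Unset Strict Implicit.
Unset Printing Implicit Defensive.
Local Open Scope ring_scope.

(** A forward error analysis needs denominators bounded below, and CG offers no such bound in
    advance: its only source is a failed test. The test is therefore read in two ways. If it
    succeeds, the computed value is compared with the exact $\Phi$ at the same stored iterate, so
    the conclusion concerns the returned vector and not the exact iterate. If it fails, the computed
    value is compared with $\Phi$ at the exact iterate, which bounds the exact residual, and hence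
    both denominators, from below.

    The amplification factor $Q$ may be exponential in $n$. There are $O(n)$ operations, so it costs
    $2^{O(n^2)}$ in total, and $C^N$ with cubic $N$ and $C \ge 2^{18} U^2$ absorbs this; every local
    estimate can thus be crude. All spectral facts come from Cauchy-Schwarz for semidefinite forms,
    without eigenvalues. *)

(** * Euclidean inner product and operator norm *)

Section InnerProduct.
Context (R : realType).
Implicit Types n : nat.

Definition inner n (x y : 'cV[R]_n) : R := \sum_(i < n) x i 0 * y i 0.

Lemma innerC n (x y : 'cV[R]_n) : inner x y = inner y x.
Proof. by apply: eq_bigr => i _; rewrite mulrC. Qed.

Lemma innerDl n (x y z : 'cV[R]_n) : inner (x + y) z = inner x z + inner y z.
Proof. by rewrite -big_split; apply: eq_bigr => i _; rewrite mxE mulrDl. Qed.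

Lemma innerZl n a (x z : 'cV[R]_n) : inner (a *: x) z = a * inner x z.
Proof. by rewrite mulr_sumr; apply: eq_bigr => i _; rewrite mxE mulrA. Qed.

Lemma innerBl n (x y z : 'cV[R]_n) : inner (x - y) z = inner x z - inner y z.
Proof. by rewrite -scaleN1r innerDl innerZl mulN1r. Qed.

Lemma innerDr n (x y z : 'cV[R]_n) : inner z (x + y) = inner z x + inner z y.
Proof. by rewrite innerC innerDl !(innerC z). Qed.

Lemma innerZr n a (x z : 'cV[R]_n) : inner z (a *: x) = a * inner z x.
Proof. by rewrite innerC innerZl innerC. Qed.

Lemma innerBr n (x y z : 'cV[R]_n) : inner z (x - y) = inner z x - inner z y.
Proof. by rewrite innerC innerBl !(innerC z). Qed.

Lemma inner0l n (x : 'cV[R]_n) : inner 0 x = 0.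
Proof. by rewrite -(scale0r 0) innerZl mul0r. Qed.

Lemma inner0r n (x : 'cV[R]_n) : inner x 0 = 0.
Proof. by rewrite innerC inner0l. Qed.

Lemma inner_trmx n (x y : 'cV[R]_n) : inner x y = (x^T *m y) 0 0.
Proof. by rewrite mxE; apply: eq_bigr => i _; rewrite mxE. Qed.

Lemma inner_mulmxl n (A : 'M[R]_n) (x y : 'cV[R]_n) :
  inner (A *m x) y = inner x (A^T *m y).
Proof. by rewrite !inner_trmx trmx_mul mulmxA. Qed.

Lemma inner_ge0 n (x : 'cV[R]_n) : 0 <= inner x x.
Proof. by apply: sumr_ge0 => i _; rewrite -expr2 sqr_ge0. Qed.

Lemma sqr_entry_le_inner n (x : 'cV[R]_n) i : x i 0 ^+ 2 <= inner x x.
Proof.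
rewrite /inner (bigD1 i) //= -expr2 lerDl.
by apply: sumr_ge0 => j _; rewrite -expr2 sqr_ge0.
Qed.

Lemma inner_eq0 n (x : 'cV[R]_n) : (inner x x == 0) = (x == 0).
Proof.
apply/eqP/eqP => [x0|->]; last exact: inner0l.
apply/matrixP => i j; rewrite ord1 mxE.
have := sqr_entry_le_inner x i; rewrite x0 => h.
by apply/eqP; rewrite -sqrf_eq0 eq_le h sqr_ge0.
Qed.

Lemma inner_gt0 n (x : 'cV[R]_n) : (0 < inner x x) = (x != 0).
Proof. by rewrite lt_def inner_ge0 andbT inner_eq0. Qed.

Lemma cV_neq0_dim n (x : 'cV[R]_n) : x != 0 -> (0 < n)%N.
Proof. by case: n x => // x /eqP[]; apply/matrixP => -[]. Qed.

Lemma norm2_ge0 n (x : 'cV[R]_n) : 0 <= norm2 x.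
Proof. exact: sqrtr_ge0. Qed.

Lemma norm2_sqr n (x : 'cV[R]_n) : norm2 x ^+ 2 = inner x x.
Proof.
rewrite /norm2 sqr_sqrtr; first by apply: eq_bigr => i _; rewrite expr2.
by apply: sumr_ge0 => i _; rewrite sqr_ge0.
Qed.

Lemma norm2_eq0 n (x : 'cV[R]_n) : (norm2 x == 0) = (x == 0).
Proof. by rewrite -inner_eq0 -norm2_sqr sqrf_eq0. Qed.

Lemma norm2_gt0 n (x : 'cV[R]_n) : (0 < norm2 x) = (x != 0).
Proof. by rewrite lt_def norm2_ge0 andbT norm2_eq0. Qed.

Lemma norm20 n : norm2 (0 : 'cV[R]_n) = 0.
Proof. by apply/eqP; rewrite norm2_eq0. Qed.

Lemma norm2_le n (x : 'cV[R]_n) c :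
  0 <= c -> (norm2 x <= c) = (inner x x <= c ^+ 2).
Proof. by move=> c0; rewrite -norm2_sqr ler_sqr ?nnegrE ?norm2_ge0. Qed.

Lemma norm2N n (x : 'cV[R]_n) : norm2 (- x) = norm2 x.
Proof. by congr Num.sqrt; apply: eq_bigr => i _; rewrite mxE sqrrN. Qed.

Lemma entry_le_norm2 n (x : 'cV[R]_n) i : `|x i 0| <= norm2 x.
Proof.
rewrite -ler_sqr ?nnegrE ?norm2_ge0 // norm2_sqr real_normK ?num_real //.
exact: sqr_entry_le_inner.
Qed.

(* Cauchy-Schwarz for the semidefinite form [<x, B y>]: the quadratic
   [<t x + y, B (t x + y)>] in [t] is nonnegative. *)
Lemma psd_CauchySchwarz n (B : 'M[R]_n) (x y : 'cV[R]_n) :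
  B^T = B -> (forall z : 'cV[R]_n, 0 <= inner z (B *m z)) ->
  inner x (B *m y) ^+ 2 <= inner x (B *m x) * inner y (B *m y).
Proof.
move=> Bsym Bpos.
have sym : inner y (B *m x) = inner x (B *m y).
  by rewrite innerC inner_mulmxl Bsym.
have quad t : 0 <= t ^+ 2 * inner x (B *m x) + 2 * t * inner x (B *m y)
                   + inner y (B *m y).
  have := Bpos (t *: x + y).
  rewrite mulmxDr -scalemxAr innerDl !innerDr !innerZl !innerZr sym.
  by move=> h; apply: (le_trans h); rewrite le_eqVlt; apply/orP; left; apply/eqP; ring.
set a := inner x (B *m x) in quad *; set c := inner y (B *m y) in quad *.
set b := inner x (B *m y) in quad *.
have a_ge0 : 0 <= a by exact: Bpos.
have [a0|a_neq0] := eqVneq a 0.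
  have -> : b = 0.
    (* For $a = 0$ the quadratic is affine in $t$; at this $t$ it equals $-1$. *)
    apply/eqP/negP => /negP b0; have := quad (- (c + 1) / (2 * b)).
    rewrite a0 mulr0 add0r.
    have -> : 2 * (- (c + 1) / (2 * b)) * b = - (c + 1) by field.
    lra.
  by rewrite a0 mul0r expr0n.
have := quad (- b / a).
have -> : (- b / a) ^+ 2 * a + 2 * (- b / a) * b + c = (a * c - b ^+ 2) / a.
  by field.
by rewrite pmulr_lge0 ?invr_gt0 ?lt_def ?a_neq0 // subr_ge0.
Qed.

Lemma CauchySchwarz n (x y : 'cV[R]_n) : `|inner x y| <= norm2 x * norm2 y.
Proof.
rewrite -ler_sqr ?nnegrE ?mulr_ge0 ?norm2_ge0 // exprMn !norm2_sqr.
rewrite real_normK ?num_real //.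
have := @psd_CauchySchwarz n 1%:M x y; rewrite !mul1mx; apply.
  exact: trmx1.
by move=> z; rewrite mul1mx inner_ge0.
Qed.

Lemma norm2_triangle n (x y : 'cV[R]_n) : norm2 (x + y) <= norm2 x + norm2 y.
Proof.
rewrite norm2_le ?addr_ge0 ?norm2_ge0 // innerDl !innerDr (innerC y x).
have := CauchySchwarz x y => /(le_trans (ler_norm _)).
by rewrite -!norm2_sqr; lra.
Qed.

Lemma norm2_le_sum n (x : 'cV[R]_n) : norm2 x <= \sum_i `|x i 0|.
Proof.
have s0 : 0 <= \sum_i `|x i 0| by apply: sumr_ge0.
rewrite norm2_le // /inner expr2 mulr_suml ler_sum // => i _.
rewrite -expr2 -[X in X <= _]real_normK ?num_real // expr2 ler_wpM2l //.
by rewrite (bigD1 i) //= lerDl sumr_ge0.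
Qed.

End InnerProduct.

Section OperatorNorm.
Context (R : realType).
Implicit Types n : nat.

(** [sup] carries information only for a set bounded above; the sum of the absolute entries is a
    sufficient bound. *)
Lemma opnorm2_has_ubound n (A : 'M[R]_n) :
  has_ubound [set norm2 (A *m x) / norm2 x | x in [set x : 'cV[R]_n | x != 0]]%classic.
Proof.
exists (\sum_i \sum_j `|A i j|) => _ [x /= x0 <-].
rewrite ler_pdivrMr ?norm2_gt0 //.
apply: (le_trans (norm2_le_sum _)); rewrite mulr_suml ler_sum // => i _.
rewrite mxE mulr_suml; apply: (le_trans (ler_norm_sum _ _ _)).
by apply: ler_sum => j _; rewrite normrM ler_wpM2l ?entry_le_norm2.
Qed.

Lemma norm2_mulmx_le n (A : 'M[R]_n) (x : 'cV[R]_n) :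
  norm2 (A *m x) <= opnorm2 A * norm2 x.
Proof.
have [->|x0] := eqVneq x 0; first by rewrite mulmx0 norm20 mulr0.
rewrite -ler_pdivrMr ?norm2_gt0 //.
by apply: ub_le_sup; [exact: opnorm2_has_ubound|exists x].
Qed.

Lemma opnorm2_ge0 n (A : 'M[R]_n) (x : 'cV[R]_n) : x != 0 -> 0 <= opnorm2 A.
Proof.
move=> x0; have := le_trans (norm2_ge0 _) (norm2_mulmx_le A x).
by rewrite pmulr_lge0 // norm2_gt0.
Qed.

Lemma inner_mulmx_le n (A : 'M[R]_n) (x : 'cV[R]_n) :
  inner x (A *m x) <= opnorm2 A * inner x x.
Proof.
apply: (le_trans (ler_norm _)); apply: (le_trans (CauchySchwarz _ _)).
rewrite -norm2_sqr expr2 mulrCA ler_wpM2l ?norm2_ge0 //.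
exact: norm2_mulmx_le.
Qed.

(* Cauchy-Schwarz in the form [<., B .>] gives
   [|B x|^4 = <B x, B x>^2 <= <B x, B (B x)> <x, B x>]. *)
Lemma psd_sqr_mulmx_le n (B : 'M[R]_n) (x : 'cV[R]_n) :
  B^T = B -> (forall z : 'cV[R]_n, 0 <= inner z (B *m z)) ->
  inner (B *m x) (B *m x) <= opnorm2 B * inner x (B *m x).
Proof.
move=> Bsym Bpos; set y := B *m x.
have [y0|y0] := eqVneq (inner y y) 0.
  have /eqP -> : y == 0 by rewrite -inner_eq0 y0.
  by rewrite !inner0r mulr0.
have ypos : 0 < inner y y by rewrite lt_def y0 inner_ge0.
have := psd_CauchySchwarz y x Bsym Bpos; rewrite -/y expr2 => h.
rewrite -(ler_pM2l ypos); apply: (le_trans h).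
by rewrite mulrA (mulrC (inner y y)) ler_wpM2r ?inner_mulmx_le.
Qed.

Lemma entry_le_opnorm2 n (A : 'M[R]_n) i j : `|A i j| <= opnorm2 A.
Proof.
have := norm2_mulmx_le A (delta_mx j 0).
have -> : norm2 (delta_mx j 0 : 'cV[R]_n) = 1.
  rewrite /norm2 (bigD1 j) //= big1 ?addr0.
    by rewrite mxE !eqxx expr1n sqrtr1.
  by move=> k kj; rewrite mxE (negPf kj) expr0n.
rewrite mulr1; apply: le_trans; rewrite -colE.
by have := entry_le_norm2 (col j A) i; rewrite mxE.
Qed.

End OperatorNorm.

(** * Conjugate gradients in exact arithmetic *)

Section ExactCG.
Context (R : realType) (n : nat) (A : 'M[R]_n) (b x0 : 'cV[R]_n).

(* Since [x / 0 = 0], the sequence stays at the solution once the residual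
   vanishes, and the identities below hold for every index. *)
Fixpoint cg_seq (k : nat) : 'cV[R]_n * 'cV[R]_n * 'cV[R]_n :=
  if k is k'.+1 then
    let: (x, r, p) := cg_seq k' in
    let a := inner r r / inner (A *m p) p in
    let r' := r - a *: (A *m p) in
    (x + a *: p, r', r' + (inner r' r' / inner r r) *: p)
  else (x0, b - A *m x0, b - A *m x0).

Definition cg_x k := (cg_seq k).1.1.
Definition cg_r k := (cg_seq k).1.2.
Definition cg_p k := (cg_seq k).2.
Definition cg_a k := inner (cg_r k) (cg_r k) / inner (A *m cg_p k) (cg_p k).
Definition cg_b k :=
  inner (cg_r k.+1) (cg_r k.+1) / inner (cg_r k) (cg_r k).

Lemma cg_xS k : cg_x k.+1 = cg_x k + cg_a k *: cg_p k.
Proof. by rewrite /cg_x /cg_a /cg_p /cg_r /=; case: (cg_seq k) => [[]]. Qed.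

Lemma cg_rS k : cg_r k.+1 = cg_r k - cg_a k *: (A *m cg_p k).
Proof. by rewrite /cg_a /cg_p /cg_r /=; case: (cg_seq k) => [[]]. Qed.

Lemma cg_pS k : cg_p k.+1 = cg_r k.+1 + cg_b k *: cg_p k.
Proof. by rewrite /cg_b /cg_p /cg_r /=; case: (cg_seq k) => [[]]. Qed.

Lemma cg_rE k : cg_r k = b - A *m cg_x k.
Proof.
elim: k => [//|k IH].
by rewrite cg_rS cg_xS IH mulmxDr -scalemxAr opprD addrA.
Qed.

Hypothesis Asym : A^T = A.
Hypothesis Apos : posdefmx A.

Lemma posdef_inner_gt0 (x : 'cV[R]_n) : x != 0 -> 0 < inner x (A *m x).
Proof. by move=> /Apos; rewrite inner_trmx mulmxA. Qed.

Lemma posdef_inner_ge0 (x : 'cV[R]_n) : 0 <= inner x (A *m x).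
Proof.
have [->|/posdef_inner_gt0/ltW//] := eqVneq x 0.
by rewrite inner0l.
Qed.

Lemma sym_inner (x y : 'cV[R]_n) : inner (A *m x) y = inner x (A *m y).
Proof. by rewrite inner_mulmxl Asym. Qed.

Lemma cg_rr_b k :
  cg_b k * inner (cg_r k) (cg_r k) = inner (cg_r k.+1) (cg_r k.+1).
Proof.
rewrite /cg_b; have [r0|r0] := eqVneq (inner (cg_r k) (cg_r k)) 0.
  have a0 : cg_a k = 0 by rewrite /cg_a r0 mul0r.
  by rewrite cg_rS a0 scale0r subr0 r0 mulr0.
by rewrite mulfVK.
Qed.

Lemma cg_p_eq0 k : inner (cg_r k) (cg_r k) = 0 -> cg_p k = 0.
Proof.
case: k => [|k] rr0; first by apply/eqP; rewrite -inner_eq0; apply/eqP.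
have /eqP r0 : cg_r k.+1 == 0 by rewrite -inner_eq0 rr0.
by rewrite cg_pS r0 /cg_b r0 inner0l mul0r scale0r addr0.
Qed.

(** The premise is an invariant still being proved: this form is applied inside the induction of
    [cg_invariants]. If the denominator vanishes, definiteness gives $p_k = 0$, and the premise then
    gives $\langle r_k, r_k\rangle = 0$. *)
Lemma cg_apAp_of k : inner (cg_r k) (cg_p k) = inner (cg_r k) (cg_r k) ->
  cg_a k * inner (A *m cg_p k) (cg_p k) = inner (cg_r k) (cg_r k).
Proof.
move=> rpk; rewrite /cg_a.
have [h|h] := eqVneq (inner (A *m cg_p k) (cg_p k)) 0; last by rewrite mulfVK.
suff -> : inner (cg_r k) (cg_r k) = 0 by rewrite !mul0r.
rewrite -rpk; have [->|] := eqVneq (cg_p k) 0; first by rewrite inner0r.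
by move=> /posdef_inner_gt0; rewrite innerC h ltxx.
Qed.

(** The four identities need one another: residual orthogonality at $k+1$ uses conjugacy at $k$, and
    conjugacy at $k+1$ uses residual orthogonality at $k+1$. *)
Lemma cg_invariants k :
  [/\ forall j, (j < k)%N -> inner (cg_r k) (cg_p j) = 0,
      forall j, (j < k)%N -> inner (cg_r k) (cg_r j) = 0,
      forall j, (j < k)%N -> inner (cg_p k) (A *m cg_p j) = 0 &
      inner (cg_r k) (cg_p k) = inner (cg_r k) (cg_r k)].
Proof.
elim: k => [//|k [rp rr pAp rpk]].
have apAp := cg_apAp_of rpk.
have rp' j : (j < k.+1)%N -> inner (cg_r k.+1) (cg_p j) = 0.
  rewrite cg_rS innerBl innerZl ltnS leq_eqVlt => /orP[/eqP->|jk].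
    by rewrite rpk apAp subrr.
  by rewrite rp // sym_inner pAp // mulr0 subrr.
have rr' j : (j < k.+1)%N -> inner (cg_r k.+1) (cg_r j) = 0.
  case: j => [|j] jk; first exact: (rp' 0%N).
  have -> : cg_r j.+1 = cg_p j.+1 - cg_b j *: cg_p j by rewrite cg_pS addrK.
  by rewrite innerBr innerZr !rp' ?mulr0 ?subrr // ltnW.
have rpS : inner (cg_r k.+1) (cg_p k.+1) = inner (cg_r k.+1) (cg_r k.+1).
  by rewrite cg_pS innerDr innerZr rp' // mulr0 addr0.
split=> // j jk.
(* A zero step length forces $p_j = 0$. Otherwise multiply by $a_j$ and replace $a_j A p_j$ by $r_j
   - r_{j+1}$: for $j < k$ everything vanishes, and for $j = k$ the choice of $b_k$ makes the two
   remaining terms cancel. *)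
have [a0|a0] := eqVneq (cg_a j) 0.
  suff -> : cg_p j = 0 by rewrite mulmx0 inner0r.
  apply/eqP/negP => /negP pj; move/eqP: a0.
  rewrite /cg_a mulf_eq0 invr_eq0 innerC (gt_eqF (posdef_inner_gt0 pj)) orbF.
  by move/eqP/cg_p_eq0 => pj0; rewrite pj0 eqxx in pj.
apply: (mulfI a0); rewrite mulr0 cg_pS innerDl innerZl mulrDr.
rewrite -[cg_a j * inner (cg_r _) _]innerZr.
have -> : cg_a j *: (A *m cg_p j) = cg_r j - cg_r j.+1.
  by rewrite cg_rS opprB addrC subrK.
rewrite innerBr rr' // sub0r.
move: jk; rewrite ltnS leq_eqVlt => /orP[/eqP->|jk].
  by rewrite mulrCA (innerC (cg_p k)) apAp cg_rr_b addNr.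
by rewrite rr' ?ltnS // pAp // !mulr0 oppr0 addr0.
Qed.

Lemma cg_r_neq0_le j k : (j <= k)%N -> cg_r k != 0 -> cg_r j != 0.
Proof.
move=> /subnKC <-; elim: (k - j)%N => [|m IH]; first by rewrite addn0.
move=> h; apply: IH; apply: contraNneq h => r0.
rewrite addnS cg_rS /cg_a r0 inner0l mul0r scale0r subr0 eqxx //.
Qed.

(** The Gram matrix $M M^T$ is diagonal with nonzero entries, so it has rank $m$, while the rank of
    $M$ is at most $n$. *)
Lemma orthogonal_family_size m (v : 'I_m -> 'cV[R]_n) :
  (forall i, v i != 0) -> (forall i j, i != j -> inner (v i) (v j) = 0) ->
  (m <= n)%N.
Proof.
move=> v0 orth; pose M := \matrix_(i < m, j < n) v i j 0.
have MM : M *m M^T = diag_mx (\row_i inner (v i) (v i)).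
  apply/matrixP => i j; rewrite !mxE; have [<-|/orth vij] := eqVneq i j.
    by rewrite mulr1n; apply: eq_bigr => k _; rewrite !mxE.
  by rewrite mulr0n; apply: (etrans _ vij); apply: eq_bigr => k _; rewrite !mxE.
have : M *m M^T \in unitmx.
  rewrite unitmxE MM det_diag unitfE; apply/prodf_neq0 => i _.
  by rewrite mxE inner_eq0.
move=> /mxrank_unit rk; rewrite -[m in (m <= _)%N]rk.
exact: leq_trans (mxrankM_maxl _ _) (rank_leq_col _).
Qed.

Lemma cg_r_n : cg_r n = 0.
Proof.
apply/eqP/negPn/negP => rn.
suff : (n.+1 <= n)%N by rewrite ltnn.
apply: (@orthogonal_family_size n.+1 (fun i => cg_r i)) => [i|i j].
  by apply: cg_r_neq0_le rn; rewrite -ltnS.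
rewrite -val_eqE /= neq_ltn => /orP[] ij; last by case: (cg_invariants i) => _ rr _ _; exact: rr.
by rewrite innerC; case: (cg_invariants j) => _ rr _ _; exact: rr.
Qed.

Lemma posdef_unitmx : A \in unitmx.
Proof.
rewrite -row_free_unit -kermx_eq0; apply/negPn/negP => k0.
have [i ri] : exists i, row i (kermx A) != 0.
  apply/existsP; apply: contraNT k0 => /existsPn h.
  by apply/eqP/row_matrixP => i; rewrite row0; apply/eqP/negPn/h.
have : (row i (kermx A))^T != 0 by rewrite -trmx0 (inj_eq trmx_inj).
move=> /posdef_inner_gt0; rewrite -sym_inner -{1}Asym -trmx_mul.
by rewrite -row_mul mulmx_ker row0 trmx0 inner0l ltxx.
Qed.

Lemma posdef_mulmxV (x : 'cV[R]_n) : A *m (invmx A *m x) = x.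
Proof. by rewrite mulmxA mulmxV ?posdef_unitmx // mul1mx. Qed.

Lemma posdef_mulVmx (x : 'cV[R]_n) : invmx A *m (A *m x) = x.
Proof. by rewrite mulmxA mulVmx ?posdef_unitmx // mul1mx. Qed.

Lemma invmx_sym : (invmx A)^T = invmx A.
Proof. by rewrite trmx_inv Asym. Qed.

Lemma invmx_inner_ge0 (x : 'cV[R]_n) : 0 <= inner x (invmx A *m x).
Proof.
rewrite -{1}[x]posdef_mulmxV sym_inner posdef_mulmxV innerC.
by rewrite -{1}[x]posdef_mulmxV sym_inner posdef_inner_ge0.
Qed.

(** The lower bound $1/\|A^{-1}\|$ on the Rayleigh quotient, obtained from [psd_sqr_mulmx_le] for
    the inverse at the point $Ax$. *)
Lemma inner_le_posdef (x : 'cV[R]_n) :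
  inner x x <= opnorm2 (invmx A) * inner x (A *m x).
Proof.
have := psd_sqr_mulmx_le (A *m x) invmx_sym invmx_inner_ge0.
by rewrite posdef_mulVmx (innerC _ x).
Qed.

Lemma norm2_invmx_le (x : 'cV[R]_n) :
  norm2 x <= opnorm2 (invmx A) * norm2 (A *m x).
Proof. by rewrite -{1}[x]posdef_mulVmx norm2_mulmx_le. Qed.

Lemma kappa2_ge1 : b != 0 -> 1 <= kappa2 A.
Proof.
move=> b0; have b_gt0 : 0 < norm2 b by rewrite norm2_gt0.
rewrite -(ler_pM2r b_gt0) mul1r /kappa2 (mulrC (opnorm2 A)) -mulrA.
apply: (le_trans (norm2_invmx_le b)); rewrite ler_wpM2l ?(opnorm2_ge0 _ b0) //.
exact: norm2_mulmx_le.
Qed.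

Lemma cg_apAp k : cg_a k * inner (A *m cg_p k) (cg_p k) = inner (cg_r k) (cg_r k).
Proof. by apply: cg_apAp_of; case: (cg_invariants k). Qed.

Lemma cg_a_ge0 k : 0 <= cg_a k.
Proof. by rewrite divr_ge0 ?inner_ge0 // sym_inner posdef_inner_ge0. Qed.

(** Pythagoras: $p_{k+1} = r_{k+1} + b_k p_k$ with $r_{k+1} \perp p_k$. *)
Lemma cg_rr_le_pp k : inner (cg_r k) (cg_r k) <= inner (cg_p k) (cg_p k).
Proof.
case: k => [//|k]; have [rp _ _ _] := cg_invariants k.+1.
rewrite {1 2}cg_pS; rewrite innerDl !innerDr !innerZl !innerZr.
rewrite (innerC (cg_p k)) rp // !mulr0 add0r addr0 lerDl mulrA.
by rewrite mulr_ge0 ?inner_ge0 // -expr2 sqr_ge0.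
Qed.

Lemma cg_p_neq0 k : cg_r k != 0 -> cg_p k != 0.
Proof.
by rewrite -!inner_gt0 => /lt_le_trans; apply; exact: cg_rr_le_pp.
Qed.

Lemma cg_a_le k : cg_r k != 0 -> cg_a k <= opnorm2 (invmx A).
Proof.
move=> /cg_p_neq0/posdef_inner_gt0; rewrite -sym_inner => pAp.
rewrite /cg_a ler_pdivrMr // sym_inner.
exact: le_trans (cg_rr_le_pp k) (inner_le_posdef _).
Qed.

(** $\langle r, A^{-1} r\rangle$ is the squared $A$-norm of the error; one step lowers it by exactly
    $a_k \langle r_k, r_k\rangle$. *)
Lemma cg_energy_le k :
  inner (cg_r k.+1) (invmx A *m cg_r k.+1) <= inner (cg_r k) (invmx A *m cg_r k).
Proof.
have [_ _ _ rpk] := cg_invariants k.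
rewrite cg_rS mulmxBr -scalemxAr posdef_mulVmx innerBl !innerBr !innerZl !innerZr.
rewrite sym_inner posdef_mulmxV (innerC (cg_p k)) rpk cg_apAp.
rewrite subrr subr0 lerBlDr lerDl.
by rewrite mulr_ge0 ?inner_ge0 // cg_a_ge0.
Qed.

Lemma cg_energy_le0 k :
  inner (cg_r k) (invmx A *m cg_r k) <= opnorm2 (invmx A) * inner (cg_r 0) (cg_r 0).
Proof.
elim: k => [|k IH]; first exact: inner_mulmx_le.
exact: le_trans (cg_energy_le k) IH.
Qed.

Lemma cg_rr_le_energy k :
  inner (cg_r k) (cg_r k) <= opnorm2 A * inner (cg_r k) (invmx A *m cg_r k).
Proof.
have := psd_sqr_mulmx_le (invmx A *m cg_r k) Asym posdef_inner_ge0.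
by rewrite posdef_mulmxV (innerC _ (cg_r k)).
Qed.

End ExactCG.

(** * Bounds on the exact iterates in terms of the condition number *)

Section ExactBounds.
Context (R : realType) (n : nat) (A : 'M[R]_n) (b x0 : 'cV[R]_n) (eps : R).
Hypothesis Asym : A^T = A.
Hypothesis Apos : posdefmx A.
Hypothesis b_neq0 : b != 0.
Hypothesis A_bnd : 2^-1 <= opnorm2 A <= 1.
Hypothesis b_bnd : 2^-1 <= norm2 b <= 1.
Hypothesis eps_bnd : 0 < eps0 eps <= 1.

Notation x := (cg_x A b x0).
Notation r := (cg_r A b x0).
Notation p := (cg_p A b x0).
Notation kappa := (kappa2 A).
Notation chi := (cst_chi A b x0).
Notation U := (cst_U A b x0 eps).
Notation P := (cst_P A b x0).
Notation d := (cst_d A eps).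

Lemma kappa_ge1 : 1 <= kappa.
Proof. exact: kappa2_ge1 b_neq0. Qed.

Lemma chi_ge1 : 1 <= chi.
Proof. by rewrite le_max lexx. Qed.

Lemma cst_d_gt0 : 0 < d.
Proof.
have /andP[e0 _] := eps_bnd; have k1 := kappa_ge1.
rewrite /cst_d; apply: divr_gt0; first by rewrite exprn_gt0.
by lra.
Qed.

Lemma opnorm2_invmx_le : opnorm2 (invmx A) <= 2 * kappa.
Proof.
have /andP[A1 _] := A_bnd; have I0 := opnorm2_ge0 (invmx A) b_neq0.
have : 2^-1 * opnorm2 (invmx A) <= kappa by rewrite ler_wpM2r.
lra.
Qed.

Lemma norm2_r0_le : norm2 (b - A *m x0) <= chi.
Proof.
have /andP[b1 b2] := b_bnd; have b0 : 0 < norm2 b by rewrite norm2_gt0.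
have : norm2 (b - A *m x0) / norm2 b <= chi by rewrite le_max lexx orbT.
rewrite ler_pdivrMr // => /le_trans; apply.
by rewrite ler_piMr //; have := chi_ge1; lra.
Qed.

Lemma inner_r0_le : inner (b - A *m x0) (b - A *m x0) <= chi ^+ 2.
Proof. by rewrite -norm2_le ?norm2_r0_le //; have := chi_ge1; lra. Qed.

(** The residual norm need not decrease along CG, but the energy does; passing to the energy and
    back costs the factor $\kappa$. *)
Lemma cg_rr_le k : inner (r k) (r k) <= kappa * chi ^+ 2.
Proof.
have /andP[A1 _] := A_bnd.
have I0 := opnorm2_ge0 (invmx A) b_neq0.
apply: (le_trans (cg_rr_le_energy b x0 Asym Apos k)).
rewrite /kappa2 -mulrA ler_wpM2l //; first lra.
apply: (le_trans (cg_energy_le0 b x0 Asym Apos k)).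
by rewrite ler_wpM2l ?inner_r0_le.
Qed.

Lemma cst_P_ge1 : 1 <= P.
Proof. by have := kappa_ge1; have := chi_ge1; rewrite /cst_P; nra. Qed.

(** Pythagoras in the $A$-inner product: $r_{k+1} = p_{k+1} - b_k p_k$ with conjugate directions. It
    bounds $p_k$ without unrolling its recursion, which would give a bound exponential in $k$. *)
Lemma cg_pAp_le k : inner (p k) (A *m p k) <= inner (r k) (A *m r k).
Proof.
case: k => [//|k]; have [_ _ pAp _] := cg_invariants b x0 Asym Apos k.+1.
have -> : r k.+1 = p k.+1 - cg_b A b x0 k *: p k by rewrite cg_pS addrK.
rewrite mulmxBr -scalemxAr innerBl !innerBr !innerZl !innerZr.
rewrite -(sym_inner Asym (p k)) (innerC (A *m p k)) !(pAp k) // !mulr0 subr0 sub0r opprK.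
by rewrite lerDl mulrA mulr_ge0 ?posdef_inner_ge0 // -expr2 sqr_ge0.
Qed.

Lemma cg_pp_le k : inner (p k) (p k) <= P ^+ 2.
Proof.
have I0 := opnorm2_ge0 (invmx A) b_neq0.
apply: (le_trans (inner_le_posdef Asym Apos _)).
have h : inner (r k) (A *m r k) <= opnorm2 A * (kappa * chi ^+ 2).
  apply: (le_trans (inner_mulmx_le _ _)).
  by rewrite ler_wpM2l ?cg_rr_le ?(opnorm2_ge0 _ b_neq0).
have := le_trans (cg_pAp_le k) h => /(ler_wpM2l I0)/le_trans; apply.
by rewrite /cst_P /kappa2 le_eqVlt; apply/orP; left; apply/eqP; ring.
Qed.

Lemma norm2_cg_r k : norm2 (r k) <= P.
Proof.
have P1 := cst_P_ge1.
rewrite norm2_le; last by lra.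
exact: le_trans (cg_rr_le_pp b x0 Asym Apos k) (cg_pp_le k).
Qed.

Lemma norm2_cg_p k : norm2 (p k) <= P.
Proof. by have P1 := cst_P_ge1; rewrite norm2_le ?cg_pp_le //; lra. Qed.

Lemma norm2_mulmx_le_norm2 (z : 'cV[R]_n) : norm2 (A *m z) <= norm2 z.
Proof.
have /andP[_ A2] := A_bnd; apply: (le_trans (norm2_mulmx_le _ _)).
by rewrite ler_piMl ?norm2_ge0.
Qed.

Lemma norm2_cg_x k : norm2 (x k) <= 2 * kappa * (1 + chi).
Proof.
have -> : x k = invmx A *m b - invmx A *m r k.
  by rewrite cg_rE mulmxBr posdef_mulVmx // subKr.
apply: (le_trans (norm2_triangle _ _)); rewrite norm2N mulrDr mulr1 lerD //.
  have /andP[_ b2] := b_bnd.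
  apply: (le_trans (norm2_mulmx_le _ _)).
  have := opnorm2_ge0 (invmx A) b_neq0; have := opnorm2_invmx_le.
  by have := norm2_ge0 b; nra.
have I0 := opnorm2_ge0 (invmx A) b_neq0; have k1 := kappa_ge1; have c1 := chi_ge1.
rewrite norm2_le; last by rewrite mulr_ge0 //; lra.
(* The energy bounds $|A^{-1} r_k|$ by $\|A^{-1}\| \chi$; going through [cg_rr_le] would lose a
   further factor $\sqrt{\kappa}$. *)
have := psd_sqr_mulmx_le (r k) (invmx_sym Asym) (invmx_inner_ge0 Asym Apos).
move=> /le_trans; apply.
have h := le_trans (cg_energy_le0 b x0 Asym Apos k) (ler_wpM2l I0 inner_r0_le).
apply: (le_trans (ler_wpM2l I0 h)).
rewrite mulrA -expr2 -exprMn ler_sqr ?nnegrE ?mulr_ge0 ?(opnorm2_ge0 _ b_neq0) //; try lra.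
by rewrite ler_wpM2r ?opnorm2_invmx_le //; lra.
Qed.

Lemma cg_a_le2 k : r k != 0 -> `|cg_a A b x0 k| <= 2 * kappa.
Proof.
move=> rk; rewrite ger0_norm ?cg_a_ge0 //.
exact: le_trans (cg_a_le Asym Apos rk) opnorm2_invmx_le.
Qed.

Lemma cg_b_le k : r k != 0 -> `|cg_b A b x0 k| <= kappa.
Proof.
move=> rk; rewrite ger0_norm ?divr_ge0 ?inner_ge0 //.
rewrite /cg_b ler_pdivrMr ?inner_gt0 // /kappa2 -mulrA.
apply: (le_trans (cg_rr_le_energy b x0 Asym Apos k.+1)).
rewrite ler_wpM2l ?(opnorm2_ge0 _ b_neq0) //.
apply: (le_trans (cg_energy_le b x0 Asym Apos k)).
exact: inner_mulmx_le.
Qed.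

(** The summand 2 in [U] is a reserve: exact quantities stay below $U - 2$, stored iterates below $U
    - 1$, and anything within distance 1 of those below $U$. *)
Lemma cst_U_ge :
  [/\ 2 + d^-1 <= U, 2 + P <= U & 2 + 2 * kappa * (1 + chi) <= U].
Proof.
have k1 := kappa_ge1; have c1 := chi_ge1; have P1 := cst_P_ge1.
have d0 : 0 < d^-1 by rewrite invr_gt0 cst_d_gt0.
have PP : P <= P ^+ 2 by rewrite expr2 ler_peMr //; lra.
have kc : 0 <= kappa * chi ^+ 2 by rewrite mulr_ge0 ?sqr_ge0 //; lra.
have kc' : 0 <= 2 * kappa * (1 + chi) by rewrite mulr_ge0 //; lra.
have h : 0 <= (2 * kappa + cst_G A + 2) * P.
  by rewrite /cst_G mulr_ge0 //; lra.
by rewrite /cst_U; split; lra.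
Qed.

Lemma cst_U_ge2 : 2 <= U.
Proof.
have [h _ _] := cst_U_ge; have : 0 < d^-1 by rewrite invr_gt0 cst_d_gt0.
by lra.
Qed.

(** The chain $\langle r,r\rangle \le \langle p,p\rangle \le \|A^{-1}\| \langle Ap,p\rangle \le
    2\kappa \langle Ap,p\rangle$ explains the constant $200\kappa$ in [d]. *)
Lemma cst_d_le_pAp k : eps0 eps ^+ 2 / 100 <= inner (r k) (r k) ->
  d <= inner (A *m p k) (p k).
Proof.
move=> h; have k1 := kappa_ge1.
rewrite (sym_inner Asym) /cst_d ler_pdivrMr; last by lra.
have := le_trans (cg_rr_le_pp b x0 Asym Apos k) (inner_le_posdef Asym Apos (p k)).
have := ler_wpM2r (posdef_inner_ge0 Apos (p k)) opnorm2_invmx_le.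
move=> h1 h2; have := le_trans h (le_trans h2 h1).
by rewrite ler_pdivrMr // => /le_trans; apply; lra.
Qed.

Lemma cst_d_le : d <= eps0 eps ^+ 2 / 100.
Proof.
have k1 := kappa_ge1; rewrite /cst_d ler_pM2l.
  by rewrite lef_pV2 ?posrE; lra.
by rewrite exprn_gt0 //; case/andP: eps_bnd.
Qed.

Lemma cst_d_lt1 : d <= 1 / 200.
Proof.
have k1 := kappa_ge1; rewrite /cst_d ler_pdivrMr; last lra.
have /andP[e0 e1] := eps_bnd.
by have := exprn_ile1 2 (ltW e0) e1; lra.
Qed.

(* If [|b - A z| <= 1/10] then [|z| >= |A z| >= 2/5]. *)
Lemma residual_lower_bound (z : 'cV[R]_n) :
  - (eps0 eps ^+ 2 / 64) < inner (b - A *m z) (b - A *m z) - eps0 eps ^+ 2 / 4 * inner z z ->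
  eps0 eps ^+ 2 / 100 <= inner (b - A *m z) (b - A *m z).
Proof.
move=> h; have /andP[e0 e1] := eps_bnd; have /andP[b1 b2] := b_bnd.
have ee : 0 <= eps0 eps ^+ 2 by rewrite sqr_ge0.
have ee1 := exprn_ile1 2 (ltW e0) e1.
have [small|big] := lerP (norm2 (b - A *m z)) (1/10); last first.
  have : (1/10) ^+ 2 <= inner (b - A *m z) (b - A *m z).
    by rewrite -norm2_sqr ler_sqr ?nnegrE ?norm2_ge0 //; lra.
  by lra.
have := norm2_triangle (b - A *m z) (A *m z); rewrite subrK.
have := norm2_mulmx_le_norm2 z => h1 h2.
have h3 : 2/5 <= norm2 z by lra.
have h4 : 4/25 <= inner z z.
  by rewrite -norm2_sqr; have := norm2_ge0 z; nra.
(* The subtracted term is now at least $\varepsilon_0^2/25$, and $1/25 - 1/64 > 1/100$. *)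
by nra.
Qed.

End ExactBounds.

(** * Propagation of rounding errors *)

Section RoundingErrors.
Context (R : realType) (fl : R -> R) (u : R).
Hypothesis u_bnd : 0 <= u <= 1.
Hypothesis flP : forall z, `|fl z - z| <= u * `|z|.

Lemma roundoff_ge0 : 0 <= u. Proof. by case/andP: u_bnd. Qed.

Lemma ler_dist_norm (v w e : R) : `|v - w| <= e -> `|v| <= `|w| + e.
Proof. by move=> h; have := ler_normD w (v - w); rewrite addrC subrK; lra. Qed.

Lemma pow1D_ge1 m : 1 <= (1 + u) ^+ m.
Proof. by apply: exprn_ege1; rewrite lerDl roundoff_ge0. Qed.

(** On $[0,1]$ the convex function $(1+u)^m$ lies below its chord, of slope $2^m - 1$; the induction
    runs with that sharper slope. *)
Lemma pow1D_le m : (1 + u) ^+ m - 1 <= 2 ^+ m * u.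
Proof.
have /andP[u0 u1] := u_bnd.
have h : (1 + u) ^+ m - 1 <= (2 ^+ m - 1) * u; last first.
  by apply: (le_trans h); rewrite ler_wpM2r //; lra.
elim: m => [|m IH]; first by rewrite !expr0 !subrr mul0r.
have m1 : 1 <= (2 : R) ^+ m by apply: exprn_ege1; lra.
have h1 := ler_wpM2l (_ : 0 <= 1 + u) IH.
have h2 : 0 <= (2 ^+ m - 1) * (u * (1 - u)) by rewrite !mulr_ge0 //; lra.
by rewrite !exprS; have {}h1 := h1 (addr_ge0 ler01 u0); lra.
Qed.

(** Here [t] is either the rounded or the exact product [y], so one estimate serves both the
    separate and the fused evaluation. *)
Lemma fl_add_err s y t :
  `|t - y| <= u * `|y| ->
  `|fl (s + t) - (s + y)| <= ((1 + u) ^+ 2 - 1) * (`|s| + `|y|).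
Proof.
have u0 := roundoff_ge0; move=> ty; have h := flP (s + t).
have h1 := ler_normD s t; have h2 := ler_dist_norm ty.
have -> : fl (s + t) - (s + y) = (fl (s + t) - (s + t)) + (t - y) by ring.
apply: (le_trans (ler_normD _ _)).
have h3 : u * `|s + t| <= u * (`|s| + (`|y| + u * `|y|)).
  by rewrite ler_wpM2l //; lra.
by have := mulr_ge0 roundoff_ge0 (mulr_ge0 roundoff_ge0 (normr_ge0 s)); have := mulr_ge0 roundoff_ge0 (normr_ge0 s); lra.
Qed.

Lemma fl_muladd_err s a c v : fl_muladd fl s a c v ->
  `|v - (s + a * c)| <= ((1 + u) ^+ 2 - 1) * (`|s| + `|a * c|).
Proof.
case=> ->; first exact/fl_add_err/flP.
by apply: fl_add_err; rewrite subrr normr0 mulr_ge0 ?roundoff_ge0.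
Qed.

Lemma fl_mulsub_err s a c v : fl_mulsub fl s a c v ->
  `|v - (s - a * c)| <= ((1 + u) ^+ 2 - 1) * (`|s| + `|a * c|).
Proof.
rewrite -(normrN (a * c)); case=> ->; apply: fl_add_err.
  by rewrite -opprD !normrN flP.
by rewrite subrr normr0 mulr_ge0 ?roundoff_ge0.
Qed.

(** Each pair costs at most two roundings, that is a factor $g = (1+u)^2$, and the bounds compose
    because $(G-1)g + (g-1) = Gg - 1$. *)
Lemma fl_accum_err l : forall s v, fl_accum fl s l v ->
  `|v - (s + \sum_(x <- l) x.1 * x.2)|
    <= ((1 + u) ^+ (2 * size l) - 1) * (`|s| + \sum_(x <- l) `|x.1 * x.2|).
Proof.
elim: l => [|[a c] l IH] s v /=.
  by move=> ->; rewrite !big_nil addr0 subrr normr0 muln0 expr0 subrr mul0r.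
move=> [s' /fl_muladd_err h1 /IH h2]; rewrite !big_cons /= mulnS exprD.
set S := \sum_(x <- l) _ in h2 *; set T := \sum_(x <- l) `|_| in h2 *.
have T0 : 0 <= T by apply: sumr_ge0.
set g := (1 + u) ^+ 2 in h1 *; set G := (1 + u) ^+ (2 * size l) in h2 *.
have g1 : 1 <= g by exact: pow1D_ge1.
have G1 : 1 <= G by exact: pow1D_ge1.
have -> : v - (s + (a * c + S)) = (v - (s' + S)) + (s' - (s + a * c)) by ring.
apply: (le_trans (ler_normD _ _)).
have h3 := ler_dist_norm h1; have h4 := ler_normD s (a * c).
have h5 : `|s'| <= g * (`|s| + `|a * c|) by lra.
have h6 : (G - 1) * (`|s'| + T) <= (G - 1) * (g * (`|s| + `|a * c|) + T).
  by rewrite ler_wpM2l ?lerD2r //; lra.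
have h7 : 0 <= (g - 1) * T * G by rewrite !mulr_ge0 //; lra.
by lra.
Qed.

Lemma fl_dot_err n (f g : 'I_n -> R) v : fl_dot fl f g v ->
  `|v - \sum_i f i * g i| <= ((1 + u) ^+ (2 * n) - 1) * \sum_i `|f i * g i|.
Proof.
have sE (h : R * R -> R) : \sum_(i < n) h (f i, g i)
    = \sum_(x <- [seq (f i, g i) | i <- enum 'I_n]) h x.
  by rewrite big_map big_enum.
have u0 := roundoff_ge0; rewrite /fl_dot (sE (fun x => x.1 * x.2)) (sE (fun x => `|x.1 * x.2|)).
have : size [seq (f i, g i) | i <- enum 'I_n] = n by rewrite size_map size_enum_ord.
case: {sE}[seq _ | _ <- _] => [|[a c] l] /= <-.
  by move=> ->; rewrite !big_nil subrr normr0 mulr0.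
move=> /fl_accum_err h; rewrite !big_cons /= mulnS exprD.
set S := \sum_(x <- l) _ in h *; set T := \sum_(x <- l) `|_| in h *.
have T0 : 0 <= T by apply: sumr_ge0.
set g2 := (1 + u) ^+ 2; set G := (1 + u) ^+ (2 * size l) in h *.
have G1 : 1 <= G by exact: pow1D_ge1.
have h1 := flP (a * c); have h3 := ler_dist_norm h1.
have -> : v - (a * c + S) = (v - (fl (a * c) + S)) + (fl (a * c) - a * c) by ring.
apply: (le_trans (ler_normD _ _)).
have h6 : (G - 1) * (`|fl (a * c)| + T) <= (G - 1) * ((1 + u) * `|a * c| + T).
  by rewrite ler_wpM2l ?lerD2r //; lra.
have g2E : 1 + u <= g2 by rewrite /g2 expr2 ler_peMr //; lra.
have h7 : G * ((1 + u) * `|a * c| + T) <= G * (g2 * (`|a * c| + T)).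
  have : 0 <= (g2 - (1 + u)) * `|a * c| by rewrite mulr_ge0 //; lra.
  have : 0 <= (g2 - 1) * T by rewrite mulr_ge0 //; lra.
  by move=> ? ?; rewrite ler_wpM2l //; lra.
by lra.
Qed.

(** * Propagation of componentwise errors through single operations *)

Section Propagation.
Variables (n : nat) (M : R).
Hypothesis n_gt0 : (0 < n)%N.
Hypothesis M_ge2 : 2 <= M.

(* Dominates the factor by which one dot product, quotient, vector update or
   residual amplifies a componentwise error, when all operands are at most [M]. *)
Definition growth : R := 64 ^+ n * M ^+ 2.

Lemma growth_ge c : c <= 64 -> c * M ^+ 2 <= growth.
Proof.
move=> c1; rewrite /growth ler_wpM2r ?sqr_ge0 // (le_trans c1) //.
by rewrite -(prednK n_gt0) exprS ler_peMr // exprn_ege1; lra.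
Qed.

Lemma growth_ge64 : 64 <= growth.
Proof.
have h := growth_ge (lexx 64); have h2 : 2 * 2 <= M ^+ 2 by rewrite expr2 ler_pM.
by lra.
Qed.

(** The origin of the base 64: $2^n$ covers the number of summands, $4^n$ the $2n$ roundings of a
    dot product, and $8^n$ the constant 4. *)
Lemma growth_ge_dot : n%:R * M ^+ 2 * (4 * 4 ^+ n) <= growth.
Proof.
rewrite /growth mulrAC ler_wpM2r ?sqr_ge0 //.
have h1 : n%:R <= (2 : R) ^+ n by rewrite -natrX ler_nat ltnW // ltn_expl.
have h2 : 0 <= (4 : R) ^+ n by apply: exprn_ge0; lra.
have h3 : 8 <= (8 : R) ^+ n.
  by rewrite -(prednK n_gt0) exprS ler_peMr // exprn_ege1 //; lra.
have -> : (64 : R) ^+ n = 2 ^+ n * (8 ^+ n * 4 ^+ n).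
  by rewrite -!exprMn; congr (_ ^+ _); ring.
rewrite ler_pM // ?ler_wpM2r ?mulr_ge0 //; lra.
Qed.

Lemma growth_ge_n : 16 * n%:R * M ^+ 2 <= growth.
Proof.
apply: (le_trans _ growth_ge_dot).
have h3 : 4 <= (4 : R) ^+ n.
  by rewrite -(prednK n_gt0) exprS ler_peMr // exprn_ege1 //; lra.
have : 0 <= n%:R * M ^+ 2 by rewrite mulr_ge0 ?sqr_ge0.
by nra.
Qed.

Local Notation Q := growth.

Section Close.
Variable e : R.
Hypothesis u_le_e : u <= e.

(** Because [u <= e], the fresh rounding error is charged to [e] together with the inherited one, so
    each operation is a pure multiplication of the error by [Q]. *)
Lemma fl_dot_close (f g f' g' : 'I_n -> R) v :
  (forall i, `|g i| <= M) -> (forall i, `|f' i| <= M) -> (forall i, `|g' i| <= M) ->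
  (forall i, `|f' i - f i| <= e) -> (forall i, `|g' i - g i| <= e) ->
  fl_dot fl f' g' v -> `|v - \sum_i f i * g i| <= Q * e.
Proof.
move=> gM f'M g'M fe ge /fl_dot_err h; have u0 := roundoff_ge0.
have h1 : \sum_i `|f' i * g' i| <= n%:R * M ^+ 2.
  apply: (@le_trans _ _ (\sum_(i < n) M ^+ 2)); last first.
    by rewrite sumr_const card_ord -[X in X <= _]mulr_natl.
  by apply: ler_sum => i _; rewrite normrM expr2 ler_pM.
have h2 : `|\sum_i f' i * g' i - \sum_i f i * g i| <= n%:R * (2 * M * e).
  rewrite -sumrB; apply: (le_trans (ler_norm_sum _ _ _)).
  apply: (@le_trans _ _ (\sum_(i < n) (2 * M * e))); last first.
    by rewrite sumr_const card_ord -[X in X <= _]mulr_natl.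
  apply: ler_sum => i _.
  have -> : f' i * g' i - f i * g i = f' i * (g' i - g i) + (f' i - f i) * g i by ring.
  apply: (le_trans (ler_normD _ _)); rewrite !normrM.
  have := ler_pM (normr_ge0 _) (normr_ge0 _) (f'M i) (ge i).
  have := ler_pM (normr_ge0 _) (normr_ge0 _) (fe i) (gM i).
  by lra.
have := ler_distD (\sum_i f' i * g' i) v (\sum_i f i * g i) => /le_trans; apply.
have h3 : ((1 + u) ^+ (2 * n) - 1) <= 4 ^+ n * e.
  apply: (le_trans (pow1D_le _)); rewrite exprM.
  have -> : (2 : R) ^+ 2 = 4 by ring.
  by rewrite ler_wpM2l // exprn_ge0 //; lra.
have h4 : ((1 + u) ^+ (2 * n) - 1) * (\sum_i `|f' i * g' i|) <= 4 ^+ n * e * (n%:R * M ^+ 2).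
  by rewrite ler_pM // ?subr_ge0 ?pow1D_ge1 ?sumr_ge0.
have h5 := ler_wpM2r (le_trans u0 u_le_e) growth_ge_dot.
have M0 : 0 <= M := le_trans (ler0n _ 2) M_ge2.
have h6 : 0 <= n%:R * M * e by rewrite !mulr_ge0 // (le_trans u0).
have e0 := le_trans u0 u_le_e.
have h7 : 4 * (n%:R * M ^+ 2 * e) <= 4 ^+ n * (n%:R * M ^+ 2 * e).
  rewrite ler_wpM2r // ?mulr_ge0 ?sqr_ge0 //.
  by rewrite -(prednK n_gt0) exprS ler_peMr // exprn_ege1 //; lra.
have h8 : 2 * (n%:R * M * e) <= n%:R * M ^+ 2 * e.
  by have := ler_wpM2r h6 M_ge2; lra.
by lra.
Qed.

(** The difference of the quotients is $((a_2 - a_1) - (a_1/c_1)(c_2 - c_1))/c_2$, so only the exact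
    quotient and the computed denominator need bounds. The latter stays above $d/2$ since $e \le
    d/2$. *)
Lemma fl_quot_close d a1 c1 a2 c2 :
  0 < d -> d^-1 <= M -> d <= 1 -> e <= d / 2 -> d <= c1 -> `|a1 / c1| <= M - 1 ->
  `|a2 - a1| <= e -> `|c2 - c1| <= e ->
  `|fl (a2 / c2) - a1 / c1| <= Q * e.
Proof.
move=> d0 dM d1 ed dc acM ae ce; have u0 := roundoff_ge0; have M2 := M_ge2.
have e0 : 0 <= e := le_trans u0 u_le_e.
have c2d : d / 2 <= c2.
  have := ler_norm (c1 - c2); rewrite distrC in ce; lra.
have c2inv : 0 <= c2^-1 <= 2 * M.
  rewrite invr_ge0; apply/andP; split; first lra.
  have h : c2^-1 <= (d / 2)^-1 by rewrite lef_pV2 ?posrE; lra.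
  by apply: (le_trans h); rewrite invf_div; lra.
have /andP[i0 i1] := c2inv.
have ei : e * c2^-1 <= 1 by rewrite ler_pdivrMr; lra.
have h1 : `|a2 / c2 - a1 / c1| <= M * (e * c2^-1).
  have -> : a2 / c2 - a1 / c1 = ((a2 - a1) - (a1 / c1) * (c2 - c1)) * c2^-1.
    by field; apply/andP; split; rewrite gt_eqF //; lra.
  rewrite normrM (ger0_norm i0) mulrA ler_wpM2r //.
  have h2 := ler_normB (a2 - a1) (a1 / c1 * (c2 - c1)).
  rewrite normrM in h2.
  have h3 := ler_pM (normr_ge0 _) (normr_ge0 _) acM ce.
  by lra.
have M0 : 0 <= M by lra.
have h2 : `|a2 / c2| <= 2 * M.
  by have := ler_dist_norm h1; have := ler_wpM2l M0 ei; lra.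
have h3 : M * (e * c2^-1) <= M * (e * (2 * M)) by rewrite !ler_wpM2l.
have h4 : u * `|a2 / c2| <= e * (2 * M) by rewrite ler_pM.
have h5 := flP (a2 / c2).
have := ler_distD (a2 / c2) (fl (a2 / c2)) (a1 / c1) => /le_trans; apply.
have h6 : 2 * (M * e) <= M ^+ 2 * e by rewrite expr2 !mulrA ler_wpM2r // ler_wpM2r.
have /(ler_wpM2r e0) : 3 * M ^+ 2 <= Q by apply: growth_ge; lra.
by lra.
Qed.

Lemma two_roundings_le : (1 + u) ^+ 2 - 1 <= 3 * e.
Proof. by have /andP[u0 u1] := u_bnd; have ue := u_le_e; rewrite expr2; nra. Qed.

Lemma axpy_error_bounds (s a c s' a' c' : R) :
  `|s'| <= M -> `|a'| <= M -> `|c| <= M -> `|c'| <= M ->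
  `|s' - s| <= e -> `|a' - a| <= e -> `|c' - c| <= e ->
  [/\ ((1 + u) ^+ 2 - 1) * (`|s'| + `|a' * c'|) <= 6 * M ^+ 2 * e,
      `|a' * c' - a * c| <= 2 * M * e & e + 2 * M * e + 6 * M ^+ 2 * e <= Q * e].
Proof.
move=> sM aM cM c'M se ae ce; have u0 := roundoff_ge0; have M2 := M_ge2; have ue := u_le_e; split.
- have h1 : `|s'| + `|a' * c'| <= 2 * M ^+ 2.
    by rewrite normrM; have := ler_pM (normr_ge0 _) (normr_ge0 _) aM c'M; nra.
  have h0 : 0 <= (1 + u) ^+ 2 - 1 by rewrite subr_ge0 pow1D_ge1.
  have := ler_pM h0 (addr_ge0 (normr_ge0 _) (normr_ge0 _)) two_roundings_le h1.
  by lra.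
- have -> : a' * c' - a * c = a' * (c' - c) + (a' - a) * c by ring.
  apply: (le_trans (ler_normD _ _)); rewrite !normrM.
  have := ler_pM (normr_ge0 _) (normr_ge0 _) aM ce.
  have := ler_pM (normr_ge0 _) (normr_ge0 _) ae cM.
  by lra.
- have e0 : 0 <= e := le_trans u0 u_le_e.
  have /(ler_wpM2r e0) : 9 * M ^+ 2 <= Q by apply: growth_ge; lra.
  move=> /(le_trans _); apply.
  have : 0 <= (M ^+ 2 * 9 - (1 + 2 * M + 6 * M ^+ 2)) * e by rewrite mulr_ge0 //; nra.
  by lra.
Qed.

Lemma fl_muladd_close s a c s' a' c' v :
  `|s'| <= M -> `|a'| <= M -> `|c| <= M -> `|c'| <= M ->
  `|s' - s| <= e -> `|a' - a| <= e -> `|c' - c| <= e ->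
  fl_muladd fl s' a' c' v -> `|v - (s + a * c)| <= Q * e.
Proof.
move=> sM aM cM c'M se ae ce /fl_muladd_err h.
have [h1 h2 h3] := axpy_error_bounds sM aM cM c'M se ae ce.
have -> : v - (s + a * c) = (v - (s' + a' * c')) + ((s' - s) + (a' * c' - a * c)) by ring.
have h4 := ler_normD (s' - s) (a' * c' - a * c).
by apply: (le_trans (ler_normD _ _)); lra.
Qed.

Lemma fl_mulsub_close s a c s' a' c' v :
  `|s'| <= M -> `|a'| <= M -> `|c| <= M -> `|c'| <= M ->
  `|s' - s| <= e -> `|a' - a| <= e -> `|c' - c| <= e ->
  fl_mulsub fl s' a' c' v -> `|v - (s - a * c)| <= Q * e.
Proof.
move=> sM aM cM c'M se ae ce /fl_mulsub_err h.
have [h1 h2 h3] := axpy_error_bounds sM aM cM c'M se ae ce.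
have -> : v - (s - a * c) = (v - (s' - a' * c')) + ((s' - s) - (a' * c' - a * c)) by ring.
have h4 := ler_normB (s' - s) (a' * c' - a * c).
by apply: (le_trans (ler_normD _ _)); lra.
Qed.

End Close.

Let Q_ge1 : 1 <= Q. Proof. by apply: le_trans growth_ge64; lra. Qed.

Lemma growth_ge_M : 2 * M <= Q.
Proof.
have M2 := M_ge2; have h : 1 * M ^+ 2 <= Q by apply: growth_ge; lra.
by apply: le_trans h; rewrite mul1r expr2 ler_wpM2r //; lra.
Qed.

Lemma fl_inner_close e (y z y' z' : 'cV[R]_n) v :
  u <= e -> (forall i, `|z i 0| <= M) -> (forall i, `|y' i 0| <= M) ->
  (forall i, `|z' i 0| <= M) ->
  (forall i, `|y' i 0 - y i 0| <= e) -> (forall i, `|z' i 0 - z i 0| <= e) ->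
  fl_dot fl (y'^~ 0) (z'^~ 0) v -> `|v - inner y z| <= Q * e.
Proof.
move=> ue zM y'M z'M ye ze /(fl_dot_close ue); apply;
  [exact: zM|exact: y'M|exact: z'M|exact: ye|exact: ze].
Qed.

Lemma fl_matvec_close e (A : 'M[R]_n) (z z' y : 'cV[R]_n) :
  u <= e -> (forall i j, `|A i j| <= 1) -> (forall i, `|z i 0| <= M) ->
  (forall i, `|z' i 0| <= M) -> (forall i, `|z' i 0 - z i 0| <= e) ->
  fl_matvec fl A z' y -> forall i, `|y i 0 - (A *m z) i 0| <= Q * e.
Proof.
move=> ue A1 zM z'M ze yE i; rewrite mxE; have M2 := M_ge2.
apply: (fl_dot_close ue _ _ _ _ _ (yE i)) => // j.
  by apply: le_trans (A1 i j) _; lra.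
by rewrite subrr normr0 (le_trans roundoff_ge0).
Qed.

Lemma fl_residual_close e (A : 'M[R]_n) (b z z' r : 'cV[R]_n) :
  u <= e -> Q * e <= 1 -> (forall i j, `|A i j| <= 1) ->
  (forall i, `|z i 0| <= M) -> (forall i, `|z' i 0| <= M) ->
  (forall i, `|(b - A *m z) i 0| <= M - 1) ->
  (forall i, `|z' i 0 - z i 0| <= e) ->
  fl_residual fl A b z' r ->
  forall i, `|r i 0 - (b - A *m z) i 0| <= Q ^+ 2 * e.
Proof.
move=> ue Qe1 A1 zM z'M rM ze [y yE rE] i; rewrite rE.
have e0 : 0 <= e := le_trans roundoff_ge0 ue.
have h := fl_matvec_close ue A1 zM z'M ze yE i.
have -> : (b - A *m z) i 0 = b i 0 - (A *m z) i 0 by rewrite !mxE.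
have h1 : `|(b i 0 - y i 0) - (b i 0 - (A *m z) i 0)| <= Q * e.
  by rewrite (_ : _ - _ = (A *m z) i 0 - y i 0); [rewrite distrC|ring].
have h2 := ler_dist_norm h1.
have h3 : `|b i 0 - y i 0| <= M by have := rM i; rewrite !mxE in h2 *; lra.
have h4 : u * `|b i 0 - y i 0| <= e * M by rewrite ler_pM ?roundoff_ge0.
have := ler_distD (b i 0 - y i 0) (fl (b i 0 - y i 0)) (b i 0 - (A *m z) i 0).
move=> /le_trans; apply; have h5 := flP (b i 0 - y i 0).
have h6 := ler_wpM2r e0 growth_ge_M; have M2 := M_ge2.
have h7 : 2 * (Q * e) <= Q ^+ 2 * e.
  by rewrite mulrA ler_wpM2r // expr2 ler_wpM2r //; have := growth_ge64; lra.
have h8 : 0 <= M * e by rewrite mulr_ge0 //; lra.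
by lra.
Qed.

(** The residual costs $Q^2$, its squared norm a third factor, the final subtraction a fourth. The
    squared norms are only bounded by $n M^2$, not by $M$, so [fl_mulsub_close] does not apply;
    [growth_ge_n] bounds them by $Q/16$ instead. *)
Lemma fl_Phi_close e (A : 'M[R]_n) (b z z' : 'cV[R]_n) (e0 v : R) :
  u <= e -> Q ^+ 2 * e <= 1 -> (forall i j, `|A i j| <= 1) ->
  (forall i, `|z i 0| <= M - 1) -> (forall i, `|z' i 0 - z i 0| <= e) ->
  (forall i, `|(b - A *m z) i 0| <= M - 1) -> 0 <= e0 <= 1 ->
  fl_Phi fl A b e0 z' v ->
  `|v - (inner (b - A *m z) (b - A *m z) - e0 ^+ 2 / 4 * inner z z)| <= Q ^+ 4 * e.
Proof.
move=> ue Q2e A1 zM1 ze rM1 /andP[e00 e01] [r [rr [xx [rE rrE xxE vE]]]].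
have u0 := roundoff_ge0; have /andP[_ u1] := u_bnd; have M2 := M_ge2.
have eps_ge0 : 0 <= e := le_trans u0 ue.
have Q1 := Q_ge1.
have Qe_le : e <= Q * e by rewrite ler_peMl.
have Qe_le2 : Q * e <= Q ^+ 2 * e.
  by rewrite ler_wpM2r // expr2 ler_peMl //; lra.
have Qe1 := le_trans Qe_le2 Q2e.
have zM i : `|z i 0| <= M by apply: le_trans (zM1 i) _; lra.
have rM i : `|(b - A *m z) i 0| <= M by apply: le_trans (rM1 i) _; lra.
have z'M i : `|z' i 0| <= M.
  by have := ler_dist_norm (ze i); have := zM1 i; lra.
have hr := fl_residual_close ue Qe1 A1 zM z'M rM1 ze rE.
have r'M i : `|r i 0| <= M.
  by have := ler_dist_norm (hr i); have := rM1 i; lra.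
have u2 : u <= Q ^+ 2 * e by lra.
have hrr := fl_inner_close u2 rM r'M r'M hr hr rrE.
have hxx := fl_inner_close ue zM z'M z'M ze ze xxE.
set c := e0 ^+ 2 / 4 in vE *; set rr0 := inner _ _ in hrr *; set xx0 := inner z z in hxx *.
have c01 : 0 <= c <= 1.
  have := exprn_ile1 2 e00 e01; have := sqr_ge0 e0.
  by rewrite /c => ? ?; apply/andP; split; lra.
have inner_le (w : 'cV[R]_n) : (forall i, `|w i 0| <= M) -> `|inner w w| <= n%:R * M ^+ 2.
  move=> wM; apply: (le_trans (ler_norm_sum _ _ _)).
  apply: (@le_trans _ _ (\sum_(i < n) M ^+ 2)); last first.
    by rewrite sumr_const card_ord -[X in X <= _]mulr_natl.
  by apply: ler_sum => i _; rewrite normrM expr2 ler_pM.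
have rr0M : `|rr0| <= n%:R * M ^+ 2 := inner_le _ rM.
have xx0M : `|xx0| <= n%:R * M ^+ 2 := inner_le _ zM.
have hn := growth_ge_n.
have E3 : Q * (Q ^+ 2 * e) = Q ^+ 3 * e by ring.
have E4 : Q ^+ 4 * e = Q * (Q ^+ 3 * e) by ring.
rewrite E3 in hrr.
have Q3 : Q * e <= Q ^+ 3 * e.
  by rewrite -E3 ler_pM2l ?(lt_le_trans _ Q1) //; lra.
have cxx : `|c * xx - c * xx0| <= Q ^+ 3 * e.
  rewrite -mulrBr normrM; have /andP[c0 c1] := c01; rewrite (ger0_norm c0).
  by apply: (le_trans _ Q3); apply: (le_trans _ hxx); rewrite ler_piMl.
have cxx0 : `|c * xx0| <= n%:R * M ^+ 2.
  rewrite normrM; have /andP[c0 c1] := c01; rewrite (ger0_norm c0).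
  by apply: (le_trans _ xx0M); rewrite ler_piMl.
have h1 := fl_mulsub_err vE.
have h2 := ler_dist_norm cxx; have h3 := ler_dist_norm hrr.
have h4 : `|rr| + `|c * xx| <= Q + 2 * (Q ^+ 3 * e) by lra.
have h5 : (1 + u) ^+ 2 - 1 <= 3 * u by rewrite expr2; nra.
have h6 : ((1 + u) ^+ 2 - 1) * (`|rr| + `|c * xx|) <= 3 * u * (Q + 2 * (Q ^+ 3 * e)).
  by rewrite ler_pM ?subr_ge0 ?pow1D_ge1 // addr_ge0.
have h7 : 0 <= Q ^+ 3 * e by rewrite mulr_ge0 // exprn_ge0 //; lra.
have h8 : u * Q <= Q ^+ 3 * e.
  apply: (le_trans _ Q3); rewrite mulrC ler_wpM2l //; lra.
have h9 : u * (Q ^+ 3 * e) <= Q ^+ 3 * e by rewrite ler_piMl.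
have -> : v - (rr0 - c * xx0) = (v - (rr - c * xx)) + ((rr - rr0) - (c * xx - c * xx0)).
  by ring.
have h10 := ler_normB (rr - rr0) (c * xx - c * xx0).
apply: (le_trans (ler_normD _ _)); rewrite E4.
have : 64 * (Q ^+ 3 * e) <= Q * (Q ^+ 3 * e) by rewrite ler_wpM2r // growth_ge64.
by lra.
Qed.

Definition entries_close (e : R) (z' z : 'cV[R]_n) :=
  forall i, `|z' i 0 - z i 0| <= e.

Lemma entries_close_le e (z' z : 'cV[R]_n) :
  (forall i, `|z i 0| <= M - 1) -> e <= 1 -> entries_close e z' z ->
  forall i, `|z' i 0| <= M.
Proof. by move=> zM e1 h i; have := ler_dist_norm (h i); have := zM i; lra. Qed.

Lemma fl_pAp_close e (A : 'M[R]_n) (p p' q : 'cV[R]_n) v :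
  u <= e -> Q * e <= 1 -> (forall i j, `|A i j| <= 1) ->
  (forall i, `|p i 0| <= M - 1) -> (forall i, `|(A *m p) i 0| <= M - 1) ->
  entries_close e p' p -> fl_matvec fl A p' q -> fl_dot fl (q^~ 0) (p'^~ 0) v ->
  `|v - inner (A *m p) p| <= Q ^+ 2 * e.
Proof.
move=> ue Qe A1 pM ApM pe qE vE; have M2 := M_ge2; have Q1 := Q_ge1.
have e0 : 0 <= e := le_trans roundoff_ge0 ue.
have eQ : e <= Q * e by rewrite ler_peMl.
have p1 i : `|p i 0| <= M by apply: (le_trans (pM i)); lra.
have p'M : forall i, `|p' i 0| <= M by apply: (entries_close_le pM _ pe); lra.
have hq := fl_matvec_close ue A1 p1 p'M pe qE.
have qM := entries_close_le ApM Qe hq.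
have -> : Q ^+ 2 * e = Q * (Q * e) by ring.
apply: (fl_inner_close _ p1 qM p'M hq _ vE); first by lra.
by move=> i; apply: (le_trans (pe i)).
Qed.

(** The powers of [Q] reached: 1 for $q$, 2 for $\langle q,p\rangle$, 3 for $a$, 4 for the new $x$
    and $r$, 5 for $\langle r,r\rangle$ of the new residual, 6 for $b$, 7 for the new $p$. *)
Lemma cg_iterate_close e d k (A : 'M[R]_n) (b x0 x r p q x1 r1 p1 : 'cV[R]_n)
    (qp rr rr' rr1 : R) :
  u <= e -> 0 < d -> d <= 1 -> d^-1 <= M -> Q ^+ 7 * e <= d / 2 ->
  (forall i j, `|A i j| <= 1) ->
  (forall k i, `|cg_x A b x0 k i 0| <= M - 1) ->
  (forall k i, `|cg_r A b x0 k i 0| <= M - 1) ->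
  (forall k i, `|cg_p A b x0 k i 0| <= M - 1) ->
  (forall k i, `|(A *m cg_p A b x0 k) i 0| <= M - 1) ->
  `|cg_a A b x0 k| <= M - 1 -> `|cg_b A b x0 k| <= M - 1 ->
  d <= inner (A *m cg_p A b x0 k) (cg_p A b x0 k) ->
  d <= inner (cg_r A b x0 k) (cg_r A b x0 k) ->
  entries_close e x (cg_x A b x0 k) -> entries_close e r (cg_r A b x0 k) ->
  entries_close e p (cg_p A b x0 k) ->
  fl_matvec fl A p q -> fl_sqnorm fl r rr -> fl_dot fl (q^~ 0) (p^~ 0) qp ->
  fl_axpy fl x (fl (rr / qp)) p x1 -> fl_axmy fl r (fl (rr / qp)) q r1 ->
  fl_sqnorm fl r1 rr1 -> fl_sqnorm fl r rr' ->
  fl_axpy fl r1 (fl (rr1 / rr')) p p1 ->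
  [/\ entries_close (Q ^+ 7 * e) x1 (cg_x A b x0 k.+1),
      entries_close (Q ^+ 7 * e) r1 (cg_r A b x0 k.+1) &
      entries_close (Q ^+ 7 * e) p1 (cg_p A b x0 k.+1)].
Proof.
move=> ue d0 d1 dM Q7 A1 xM rM pM ApM aM bM dqp drr xe re pe.
move=> qE rrE qpE x1E r1E rr1E rr'E p1E.
have u0 := roundoff_ge0; have M2 := M_ge2; have Q1 := Q_ge1.
have e0 : 0 <= e := le_trans u0 ue.
have mono i j : (i <= j)%N -> Q ^+ i * e <= Q ^+ j * e.
  by move=> ij; rewrite ler_wpM2r // ler_weXn2l.
have le7 i : (i <= 7)%N -> Q ^+ i * e <= d / 2.
  by move=> ij; apply: (le_trans (mono _ _ ij)).
have le71 i : (i <= 7)%N -> Q ^+ i * e <= 1 by move=> ij; have := le7 i ij; lra.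
have ueQ i : u <= Q ^+ i * e by apply: (le_trans ue); have := mono 0%N i isT; rewrite mul1r.
have E i : Q ^+ i.+1 * e = Q * (Q ^+ i * e) by rewrite exprS mulrA.
have incr i j z' z : (i <= j)%N ->
    entries_close (Q ^+ i * e) z' z -> entries_close (Q ^+ j * e) z' z.
  by move=> ij h t; apply: (le_trans (h t)); exact: mono.
have mle (v : R) : v <= M - 1 -> v <= M by lra.
have up z' z : entries_close e z' z -> entries_close (Q ^+ 0 * e) z' z.
  by move=> h i; rewrite mul1r.
move: xe re pe => /up xe /up re /up pe.
have e1 : e <= 1 by have := le71 0%N isT; rewrite mul1r.
have xM' := entries_close_le (xM k) (le71 0%N isT) xe.
have rM' := entries_close_le (rM k) (le71 0%N isT) re.
have pM' := entries_close_le (pM k) (le71 0%N isT) pe.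
have hq := fl_matvec_close (ueQ 0%N) A1 (fun i => mle _ (pM k i)) pM' pe qE.
have {}hq : entries_close (Q ^+ 1 * e) q (A *m cg_p A b x0 k) by move=> i; rewrite E.
have qM := entries_close_le (ApM k) (le71 1%N isT) hq.
have hqp := fl_inner_close (ueQ 1%N) (fun i => mle _ (pM k i)) qM pM' hq
  (incr 0%N 1%N _ _ isT pe) qpE.
have sq j (z' z : 'cV[R]_n) v : (j < 7)%N -> (forall i, `|z i 0| <= M - 1) ->
    entries_close (Q ^+ j * e) z' z -> fl_sqnorm fl z' v ->
    `|v - inner z z| <= Q ^+ j.+1 * e.
  move=> j7 zM zc vE; have z'M := entries_close_le zM (le71 j (ltnW j7)) zc.
  by rewrite E; exact: (fl_inner_close (ueQ j) (fun i => mle _ (zM i)) z'M z'M zc zc vE).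
have hrr := sq 0%N _ _ _ isT (rM k) re rrE.
have hrr' := sq 0%N _ _ _ isT (rM k) re rr'E.
rewrite -E in hqp.
have ha : `|fl (rr / qp) - cg_a A b x0 k| <= Q ^+ 3 * e.
  rewrite E; apply: (fl_quot_close (ueQ 2%N) d0 dM d1 (le7 2%N isT) dqp aM) => //.
  exact: le_trans hrr (mono 1%N 2%N isT).
have aM' : `|fl (rr / qp)| <= M.
  by have := ler_dist_norm ha; have := le71 3%N isT; lra.
have a0 : `|cg_a A b x0 k| <= M := mle _ aM.
have hx1 : entries_close (Q ^+ 4 * e) x1 (cg_x A b x0 k.+1).
  move=> i; rewrite cg_xS !mxE E.
  apply: (fl_muladd_close (ueQ 3%N) (xM' i) aM' (mle _ (pM k i)) (pM' i) _ ha _ (x1E i)).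
    exact: (incr 0%N 3%N _ _ isT xe).
  exact: (incr 0%N 3%N _ _ isT pe).
have hr1 : entries_close (Q ^+ 4 * e) r1 (cg_r A b x0 k.+1).
  move=> i; rewrite cg_rS !mxE E.
  have := ApM k i; have := incr 1%N 3%N _ _ isT hq i; rewrite !mxE => hqi Ai.
  apply: (fl_mulsub_close (ueQ 3%N) (rM' i) aM' (mle _ Ai) (qM i) _ ha hqi (r1E i)).
  exact: (incr 0%N 3%N _ _ isT re).
have rM1 := entries_close_le (rM k.+1) (le71 4%N isT) hr1.
have hrr1 := sq 4%N _ _ _ isT (rM k.+1) hr1 rr1E.
have hb : `|fl (rr1 / rr') - cg_b A b x0 k| <= Q ^+ 6 * e.
  rewrite E; apply: (fl_quot_close (ueQ 5%N) d0 dM d1 (le7 5%N isT) drr bM) => //.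
  exact: le_trans hrr' (mono 1%N 5%N isT).
have bM' : `|fl (rr1 / rr')| <= M.
  by have := ler_dist_norm hb; have := le71 6%N isT; lra.
split; [exact: (incr 4%N 7%N _ _ isT hx1)|exact: (incr 4%N 7%N _ _ isT hr1)|].
move=> i; rewrite cg_pS !mxE E.
apply: (fl_muladd_close (ueQ 6%N) (rM1 i) bM' (mle _ (pM k i)) (pM' i) _ hb _ (p1E i)).
  exact: (incr 4%N 6%N _ _ isT hr1).
exact: (incr 0%N 6%N _ _ isT pe).
Qed.

End Propagation.
End RoundingErrors.

(** The stored iterate at index $k$ carries exponent $7k + 2$, and evaluating the test adds 4. *)
Lemma err_exponent_le k n : (k <= n)%N -> (4 + (7 * k + 2) <= 7 * n + 7)%N.
Proof. by lia. Qed.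

(** * The computed iterates *)

Section Execution.
Context (R : realType) (n : nat) (A : 'M[R]_n) (b x0 : 'cV[R]_n) (eps : R).
Context (fl : R -> R) (u : R).
Hypothesis Asym : A^T = A.
Hypothesis Apos : posdefmx A.
Hypothesis b_neq0 : b != 0.
Hypothesis A_bnd : 2^-1 <= opnorm2 A <= 1.
Hypothesis b_bnd : 2^-1 <= norm2 b <= 1.
Hypothesis eps_bnd : 0 < eps0 eps <= 1.
Hypothesis u_bnd : 0 <= u <= 1.
Hypothesis flP : forall z, `|fl z - z| <= u * `|z|.

Notation x := (cg_x A b x0).
Notation r := (cg_r A b x0).
Notation p := (cg_p A b x0).
Notation U := (cst_U A b x0 eps).
Notation d := (cst_d A eps).
Notation Q := (growth n U).
Notation e0 := (eps0 eps).

Hypothesis u_small : Q ^+ (7 * n + 7) * u <= d / 4.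

(* The initial residual costs two factors [Q], each iteration seven. *)
Definition err k := Q ^+ (7 * k + 2) * u.

Let n_gt0 : (0 < n)%N. Proof. exact: (cV_neq0_dim b_neq0). Qed.

Let U_ge2 : 2 <= U. Proof. exact: (cst_U_ge2 x0 Asym Apos b_neq0 eps_bnd). Qed.

Lemma A_entry_le1 i j : `|A i j| <= 1.
Proof. by have /andP[_ A2] := A_bnd; exact: le_trans (entry_le_opnorm2 A i j) A2. Qed.

Lemma pow_growth_le m : (m <= 7 * n + 7)%N -> Q ^+ m * u <= d / 4.
Proof.
have /andP[u0 _] := u_bnd.
move=> mn; apply: le_trans u_small; rewrite ler_wpM2r // ler_weXn2l //.
by have := growth_ge64 n_gt0 U_ge2; lra.
Qed.

Lemma cg_x_le k i : `|x k i 0| <= U - 2.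
Proof.
apply: (le_trans (entry_le_norm2 _ _)).
have [_ _ h] := cst_U_ge x0 Asym Apos b_neq0 eps_bnd.
have := norm2_cg_x x0 Asym Apos b_neq0 A_bnd b_bnd k; lra.
Qed.

Lemma cg_r_le k i : `|r k i 0| <= U - 2.
Proof.
apply: (le_trans (entry_le_norm2 _ _)).
have [_ h _] := cst_U_ge x0 Asym Apos b_neq0 eps_bnd.
have := norm2_cg_r x0 Asym Apos b_neq0 A_bnd b_bnd k; lra.
Qed.

Lemma cg_p_le k i : `|p k i 0| <= U - 2.
Proof.
apply: (le_trans (entry_le_norm2 _ _)).
have [_ h _] := cst_U_ge x0 Asym Apos b_neq0 eps_bnd.
have := norm2_cg_p x0 Asym Apos b_neq0 A_bnd b_bnd k; lra.
Qed.

Lemma cg_Ap_le k i : `|(A *m p k) i 0| <= U - 2.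
Proof.
apply: (le_trans (entry_le_norm2 _ _)).
apply: (le_trans (norm2_mulmx_le_norm2 A_bnd _)).
have [_ h _] := cst_U_ge x0 Asym Apos b_neq0 eps_bnd.
have := norm2_cg_p x0 Asym Apos b_neq0 A_bnd b_bnd k; lra.
Qed.

Lemma cg_ab_le k : r k != 0 ->
  `|cg_a A b x0 k| <= U - 1 /\ `|cg_b A b x0 k| <= U - 1.
Proof.
move=> rk; have [_ _ h] := cst_U_ge x0 Asym Apos b_neq0 eps_bnd.
have k1 := kappa_ge1 Asym Apos b_neq0; have c1 := chi_ge1 A b x0.
have h1 : 2 * kappa2 A <= 2 * kappa2 A * (1 + cst_chi A b x0).
  by rewrite ler_peMr; lra.
split.
  by have := cg_a_le2 Asym Apos b_neq0 A_bnd rk; lra.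
by have := cg_b_le Asym Apos b_neq0 rk; lra.
Qed.

(** The factor 1/4 in the test gives $|b - Az| \le (\varepsilon_0/2)|z|$, and $\|A\| \ge 1/2$ makes
    up for the 2. The vector $z = 0$ is excluded because there $\Phi = |b|^2 > 0$. *)
Lemma backward_error_bound (z : 'cV[R]_n) :
  inner (b - A *m z) (b - A *m z) <= e0 ^+ 2 / 4 * inner z z ->
  [/\ z != 0, eta A b z <= eta_A A b z & eta_A A b z <= e0].
Proof.
move=> h; have /andP[A1 _] := A_bnd; have /andP[e0_gt0 _] := eps_bnd.
have z0 : z != 0.
  apply: contraTneq h => ->; rewrite mulmx0 subr0 inner0l mulr0 -ltNge.
  by rewrite inner_gt0.
have nz : 0 < norm2 z by rewrite norm2_gt0.
have Az : 0 < opnorm2 A * norm2 z by rewrite mulr_gt0 //; lra.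
have hr : norm2 (b - A *m z) <= e0 / 2 * norm2 z.
  rewrite norm2_le ?mulr_ge0 ?norm2_ge0 //; last by lra.
  by rewrite exprMn norm2_sqr expr_div_n (_ : 2 ^+ 2 = 4) //; ring.
split=> //.
  rewrite /eta /eta_A ler_wpM2l ?norm2_ge0 // lef_pV2 ?posrE //.
    by rewrite lerDl norm2_ge0.
  by rewrite addr_gt0 // norm2_gt0.
rewrite /eta_A ler_pdivrMr //; apply: (le_trans hr).
by rewrite mulrA ler_wpM2r ?norm2_ge0 // ler_wpM2l //; lra.
Qed.

Lemma err_bounds k : (k <= n)%N ->
  [/\ u <= err k, Q ^+ 4 * err k <= d / 4 & Q * err k <= Q ^+ 2 * err k].
Proof.
move=> kn; have /andP[u0 _] := u_bnd; have Q1 := growth_ge64 n_gt0 U_ge2.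
split; rewrite /err.
- by rewrite ler_peMl // exprn_ege1 //; lra.
- by rewrite mulrA -exprD; apply: pow_growth_le; exact: err_exponent_le.
- rewrite ler_wpM2r ?mulr_ge0 ?exprn_ge0 //; first by lra.
  by rewrite expr2 ler_peMr; lra.
Qed.

Lemma mulmx_entry_le (e : R) (z : 'cV[R]_n) : 0 <= e ->
  (forall i, `|z i 0| <= e) -> forall i, `|(A *m z) i 0| <= Q * e.
Proof.
move=> e_ge0 ze i; rewrite mxE; apply: (le_trans (ler_norm_sum _ _ _)).
apply: (@le_trans _ _ (\sum_(j < n) e)).
  apply: ler_sum => j _; rewrite normrM -[e]mul1r.
  by rewrite ler_pM // A_entry_le1.
rewrite sumr_const card_ord -[X in X <= _]mulr_natl ler_wpM2r //.
apply: (le_trans _ (growth_ge_n U n_gt0)); have U2 := U_ge2.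
have U1 : 1 * 1 <= U ^+ 2 by rewrite expr2 ler_pM //; lra.
rewrite mulrAC ler_peMl //; lra.
Qed.

(** [fl_Phi_close] is applied with [z] in both roles and error [u]: the test is off by at most $Q^4
    u \le d/4 \le \varepsilon_0^2/400$, less than the threshold $\varepsilon_0^2/256$. Closeness to
    [x k] serves to bound the entries of [z] and of its residual. *)
Lemma fl_Phi_computed k (z : 'cV[R]_n) v : (k <= n)%N ->
  entries_close (err k) z (x k) -> fl_Phi fl A b e0 z v ->
  v <= - (e0 ^+ 2 / 256) ->
  inner (b - A *m z) (b - A *m z) <= e0 ^+ 2 / 4 * inner z z.
Proof.
move=> kn zx zE vneg; have [ue e4 eQ] := err_bounds kn.
have /andP[u0 u1] := u_bnd; have Q1 := growth_ge64 n_gt0 U_ge2.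
have err0 : 0 <= err k := le_trans u0 ue.
have d0 := cst_d_gt0 Asym Apos b_neq0 eps_bnd.
have d1 := cst_d_lt1 Asym Apos b_neq0 eps_bnd.
have dle := cst_d_le Asym Apos b_neq0 eps_bnd.
have /andP[e00 e01] := eps_bnd.
have Qm m : (m <= 4)%N -> Q ^+ m * err k <= 1.
  move=> m4; apply: (@le_trans _ _ (Q ^+ 4 * err k)); last by lra.
  by rewrite ler_wpM2r // ler_weXn2l //; lra.
have e1 : err k <= 1 by have := Qm 0%N isT; rewrite mul1r.
have Qe1 : Q * err k <= 1 by have := Qm 1%N isT; rewrite expr1.
have zM i : `|z i 0| <= U - 1.
  by have := ler_dist_norm (zx i); have := cg_x_le k i; lra.
have rM i : `|(b - A *m z) i 0| <= U - 1.
  have -> : b - A *m z = r k - A *m (z - x k).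
    by rewrite cg_rE mulmxBr opprB addrA subrK.
  have h : `|(A *m (z - x k)) i 0| <= Q * err k.
    by apply: mulmx_entry_le => // j; have := zx j; rewrite !mxE.
  have := cg_r_le k i; have := ler_normB (r k i 0) ((A *m (z - x k)) i 0).
  by rewrite 3!mxE; move: h; rewrite mxE; lra.
have Q4 : Q ^+ 4 * u <= d / 4.
  by apply: pow_growth_le; rewrite (leq_trans _ (leq_addl _ _)).
have Q2 : Q ^+ 2 * u <= 1.
  have : Q ^+ 2 * u <= d / 4; last by lra.
  by apply: pow_growth_le; rewrite (leq_trans _ (leq_addl _ _)).
have zz i : `|z i 0 - z i 0| <= u by rewrite subrr normr0.
have e0b : 0 <= e0 <= 1 by rewrite e01 ltW.
have := fl_Phi_close u_bnd flP n_gt0 U_ge2 (lexx u) Q2 A_entry_le1 zM zz rM e0b zE.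
rewrite ler_distlC => /andP[_ h].
have ee : 0 <= e0 ^+ 2 by rewrite sqr_ge0.
by lra.
Qed.

(** Now the comparison is with the exact iterate. The loss is again at most $\varepsilon_0^2/400$,
    and $1/256 + 1/400 < 1/64$ meets the premise of [residual_lower_bound]. *)
Lemma fl_Phi_exact k (z : 'cV[R]_n) v : (k <= n)%N ->
  entries_close (err k) z (x k) -> fl_Phi fl A b e0 z v ->
  - (e0 ^+ 2 / 256) < v -> e0 ^+ 2 / 100 <= inner (r k) (r k).
Proof.
move=> kn zx zE vpos; have [ue e4 eQ] := err_bounds kn.
have /andP[u0 u1] := u_bnd; have Q1 := growth_ge64 n_gt0 U_ge2.
have err0 : 0 <= err k := le_trans u0 ue.
have d0 := cst_d_gt0 Asym Apos b_neq0 eps_bnd.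
have d1 := cst_d_lt1 Asym Apos b_neq0 eps_bnd.
have dle := cst_d_le Asym Apos b_neq0 eps_bnd.
have /andP[e00 e01] := eps_bnd.
have Q2 : Q ^+ 2 * err k <= 1.
  apply: (@le_trans _ _ (Q ^+ 4 * err k)); last by lra.
  by rewrite ler_wpM2r // ler_weXn2l //; lra.
have zM i : `|x k i 0| <= U - 1 by have := cg_x_le k i; lra.
have rM i : `|(b - A *m x k) i 0| <= U - 1.
  by rewrite -cg_rE; have := cg_r_le k i; lra.
have e0b : 0 <= e0 <= 1 by rewrite e01 ltW.
have := fl_Phi_close u_bnd flP n_gt0 U_ge2 ue Q2 A_entry_le1 zM zx rM e0b zE.
rewrite ler_distl => /andP[_ h].
have ee : 0 <= e0 ^+ 2 by rewrite sqr_ge0.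
rewrite cg_rE; apply: (residual_lower_bound A_bnd b_bnd eps_bnd).
by lra.
Qed.

Lemma inner_entries_le (e : R) (z : 'cV[R]_n) : 0 <= e <= 1 ->
  (forall i, `|z i 0| <= e) -> inner z z <= Q * e.
Proof.
move=> /andP[e_ge0 e_le1] ze.
apply: (@le_trans _ _ (\sum_(j < n) e)).
  apply: ler_sum => j _; rewrite -expr2 -real_normK ?num_real // expr2.
  by rewrite -[leRHS]mul1r ler_pM // (le_trans (ze j)).
rewrite sumr_const card_ord -[X in X <= _]mulr_natl ler_wpM2r //.
apply: (le_trans _ (growth_ge_n U n_gt0)); have U2 := U_ge2.
have U1 : 1 * 1 <= U ^+ 2 by rewrite expr2 ler_pM //; lra.
rewrite mulrAC ler_peMl //; lra.
Qed.

(** A zero stored residual or a zero computed denominator would lie within $d/4$ of an exact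
    quantity that the failed test keeps above [d]. That test also gives $r_k \ne 0$, hence $k < n$
    because $r_n = 0$. *)
Lemma cg_step_close k (z rr pp : 'cV[R]_n) st : (k <= n)%N ->
  entries_close (err k) z (x k) -> entries_close (err k) rr (r k) ->
  entries_close (err k) pp (p k) ->
  cg_step fl A b e0 (CGRun z rr pp) st ->
  (st = CGReturn z /\
    inner (b - A *m z) (b - A *m z) <= e0 ^+ 2 / 4 * inner z z) \/
  ((k < n)%N /\ exists z' rr' pp', [/\ st = CGRun z' rr' pp',
    entries_close (err k.+1) z' (x k.+1),
    entries_close (err k.+1) rr' (r k.+1) &
    entries_close (err k.+1) pp' (p k.+1)]).
Proof.
move=> kn zx rrr ppp.
have /andP[u0 u1] := u_bnd; have Q1 := growth_ge64 n_gt0 U_ge2.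
have [ue e4 eQ] := err_bounds kn.
have err0 : 0 <= err k := le_trans u0 ue.
have d0 := cst_d_gt0 Asym Apos b_neq0 eps_bnd.
have d1 := cst_d_lt1 Asym Apos b_neq0 eps_bnd.
have dle := cst_d_le Asym Apos b_neq0 eps_bnd.
have Qm m : (m <= 4)%N -> Q ^+ m * err k <= d / 4.
  by move=> m4; apply: (le_trans _ e4); rewrite ler_wpM2r // ler_weXn2l //; lra.
have e1 : err k <= 1 by have := Qm 0%N isT; rewrite mul1r; lra.
have Qe1 : Q * err k <= d / 4 by have := Qm 1%N isT; rewrite expr1.
have Qe2 := Qm 2 isT.
have Qe1' : Q * err k <= 1 by lra.
have goes : e0 ^+ 2 / 100 <= inner (r k) (r k) ->
    [/\ (k < n)%N, r k != 0, d <= inner (r k) (r k) & d <= inner (A *m p k) (p k)].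
  move=> h; have rk : r k != 0 by rewrite -inner_gt0; lra.
  split=> //; last exact: (cst_d_le_pAp Asym Apos b_neq0 A_bnd h).
    rewrite ltn_neqAle kn andbT; apply: contraNneq rk => ->.
    by rewrite cg_r_n.
  by lra.
have rM1 i : `|r k i 0| <= U - 1 by have := cg_r_le k i; lra.
have rM i : `|r k i 0| <= U by have := cg_r_le k i; lra.
have pM i : `|p k i 0| <= U - 1 by have := cg_p_le k i; lra.
have ApM i : `|(A *m p k) i 0| <= U - 1 by have := cg_Ap_le k i; lra.
have rrM := entries_close_le rM1 e1 rrr.
move eqs : (CGRun z rr pp) => s0 st1; case: st1 eqs => {s0 st}.
- move=> z' r' p' v vE vneg [? ? ?]; subst z' r' p'; left; split=> //.
  exact: fl_Phi_computed kn zx vE vneg.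
- move=> z' r' p' v vE vpos r0 [ez er _]; move: vE r0; rewrite -ez -er => vE r0.
  have [_ _ drr _] := goes (fl_Phi_exact kn zx vE vpos).
  have h : inner (r k) (r k) <= Q * err k.
    apply: inner_entries_le; first by rewrite err0 e1.
    by move=> i; have := rrr i; rewrite r0 mxE sub0r normrN.
  by exfalso; lra.
- move=> z' r' p' v q qp rho vE vpos r0 qE qpE rhoE deg [? ? ?]; subst z' r' p'.
  have [_ _ drr dpAp] := goes (fl_Phi_exact kn zx vE vpos).
  have h1 := fl_pAp_close u_bnd flP n_gt0 U_ge2 ue Qe1' A_entry_le1 pM ApM ppp qE qpE.
  have h2 := fl_inner_close u_bnd flP n_gt0 U_ge2 ue rM rrM rrM rrr rrr rhoE.
  exfalso; case: deg => deg.
    by move: h1; rewrite deg sub0r normrN => /(le_trans (ler_norm _)); lra.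
  by move: h2; rewrite deg sub0r normrN => /(le_trans (ler_norm _)); lra.
- move=> z' r' p' v q qp rho rho' x1 r1 rho1 p1 vE vpos r0 qE rhoE qpE qp0 x1E r1E.
  move=> rho1E rho'E rho'0 p1E [? ? ?]; subst z' r' p'.
  have [kn' rk drr dpAp] := goes (fl_Phi_exact kn zx vE vpos).
  right; split=> //; exists x1, r1, p1.
  have errS : err k.+1 = Q ^+ 7 * err k.
    by rewrite /err mulrA -exprD mulnS addnA.
  have [h0 _ _] := cst_U_ge x0 Asym Apos b_neq0 eps_bnd.
  have [aM bM] := cg_ab_le rk.
  have Q7 : Q ^+ 7 * err k <= d / 2.
    rewrite -errS /err; have : Q ^+ (7 * k.+1 + 2) * u <= d / 4.
      apply: pow_growth_le; apply: leq_trans (err_exponent_le kn').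
      by rewrite leq_addl.
    by lra.
  have [] := @cg_iterate_close _ fl u u_bnd flP n U n_gt0 U_ge2 (err k) d k A
    b x0 z rr pp q x1 r1 p1 qp rho rho' rho1 ue d0 _ _ Q7 A_entry_le1 _ _ _ _
    aM bM dpAp drr zx rrr ppp qE rhoE qpE x1E r1E rho1E rho'E p1E.
  + by lra.
  + by lra.
  + by move=> j i; have := cg_x_le j i; lra.
  + by move=> j i; have := cg_r_le j i; lra.
  + by move=> j i; have := cg_p_le j i; lra.
  + by move=> j i; have := cg_Ap_le j i; lra.
  + by rewrite errS.
Qed.

Lemma cg_start_close r0 : fl_residual fl A b x0 r0 ->
  entries_close (err 0) r0 (r 0).
Proof.
move=> rE; have /andP[u0 u1] := u_bnd.
have d1 := cst_d_lt1 Asym Apos b_neq0 eps_bnd.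
apply: (fl_residual_close u_bnd flP n_gt0 U_ge2 (lexx u) _ A_entry_le1 _ _ _ _ rE).
- have := @pow_growth_le 1%N (@leq_trans 7 1 _ isT (leq_addl _ _)).
  by rewrite expr1; lra.
- by move=> i; have := cg_x_le 0 i; rewrite /cg_x /=; lra.
- by move=> i; have := cg_x_le 0 i; rewrite /cg_x /=; lra.
- by move=> i; have := cg_r_le 0 i; rewrite /cg_r /=; lra.
- by move=> i; rewrite subrr normr0.
Qed.

Lemma cg_execution_stops (s : nat -> cg_state R n) :
  cg_execution fl A b x0 e0 s ->
  exists i z rr pp, [/\ (i <= n)%N, s i = CGRun z rr pp, s i.+1 = CGReturn z &
    inner (b - A *m z) (b - A *m z) <= e0 ^+ 2 / 4 * inner z z].
Proof.
move=> [[r0 r0E s0] next].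
have /andP[u0 u1] := u_bnd.
pose stops := exists i z rr pp, [/\ (i <= n)%N, s i = CGRun z rr pp,
  s i.+1 = CGReturn z &
  inner (b - A *m z) (b - A *m z) <= e0 ^+ 2 / 4 * inner z z].
have step k z rr pp : (k <= n)%N -> s k = CGRun z rr pp ->
    entries_close (err k) z (x k) -> entries_close (err k) rr (r k) ->
    entries_close (err k) pp (p k) -> stops \/
    ((k < n)%N /\ exists z' rr' pp', [/\ s k.+1 = CGRun z' rr' pp',
      entries_close (err k.+1) z' (x k.+1),
      entries_close (err k.+1) rr' (r k.+1) &
      entries_close (err k.+1) pp' (p k.+1)]).
  move=> kn sk zx rrr ppp; have := next k; rewrite sk => st.
  case: (cg_step_close kn zx rrr ppp st) => [[sS h]|]; last by right.
  by left; exists k, z, rr, pp.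
have run k : (k <= n)%N -> stops \/ exists z rr pp, [/\ s k = CGRun z rr pp,
    entries_close (err k) z (x k), entries_close (err k) rr (r k) &
    entries_close (err k) pp (p k)].
  elim: k => [_|k IH kn].
    right; exists x0, r0, r0; split=> //; try exact: cg_start_close.
    by move=> i; rewrite subrr normr0 mulr_ge0 // exprn_ge0 // mulr_ge0 ?sqr_ge0 // exprn_ge0.
  case: (IH (ltnW kn)) => [|[z [rr [pp [sk zx rrr ppp]]]]]; first by left.
  by case: (step k z rr pp (ltnW kn) sk zx rrr ppp) => [|[]]; [left|right].
case: (run n (leqnn n)) => [//|[z [rr [pp [sn zx rrr ppp]]]]].
by case: (step n z rr pp (leqnn n) sn zx rrr ppp) => [//|[]]; rewrite ltnn.
Qed.

End Execution.

(** * Precision bounds *)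

Section Logarithms.
Context (R : realType).
Implicit Types x y : R.

Lemma ln2_gt0 : 0 < ln 2 :> R.
Proof. by apply: ln_gt0; lra. Qed.

Lemma log2_le x y : 0 < x -> 0 < y -> (log2 x <= log2 y) = (x <= y).
Proof. by move=> x0 y0; rewrite /log2 ler_pM2r ?invr_gt0 ?ln2_gt0 // ler_ln ?posrE. Qed.

Lemma log2M x y : 0 < x -> 0 < y -> log2 (x * y) = log2 x + log2 y.
Proof. by move=> x0 y0; rewrite /log2 lnM ?posrE // mulrDl. Qed.

Lemma log2X n x : 0 < x -> log2 (x ^+ n) = n%:R * log2 x.
Proof. by move=> x0; rewrite /log2 lnXn // !mulrnAl mul1r. Qed.

Lemma log2_exprz (e : int) : log2 (2 ^ e : R) = e%:~R.
Proof.
rewrite -powR_intmul // /log2 ln_powR mulfK //.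
by rewrite gt_eqF // ln2_gt0.
Qed.

Lemma floor_log2 x : 0 < x ->
  2 ^ Num.floor (log2 x) <= x < 2 ^ (Num.floor (log2 x) + 1).
Proof.
move=> x0; have pow0 (e : int) : 0 < (2 : R) ^ e by rewrite exprz_gt0.
apply/andP; split; first by rewrite -log2_le // log2_exprz floor_le.
by rewrite ltNge -log2_le // log2_exprz -ltNge floorD1_gt.
Qed.

Lemma log2_ge0 x : 1 <= x -> 0 <= log2 x.
Proof. move=> x1; apply: divr_ge0; [exact: ln_ge0|exact/ltW/ln2_gt0]. Qed.

Lemma log2_le_pow m x y : 0 < x -> 0 < y -> x <= y ^+ m -> log2 x <= m%:R * log2 y.
Proof. by move=> x0 y0 h; rewrite -log2X // log2_le // exprn_gt0. Qed.

Lemma eps0_bounds (eps : R) : 0 < eps ->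
  [/\ 0 < eps0 eps, eps0 eps <= eps & eps < 2 * eps0 eps].
Proof.
move=> e0; have /andP[h1 h2] := floor_log2 e0; split=> //.
  by rewrite exprz_gt0.
move: h2; rewrite expfzDr ?expr1z 1?mulrC //.
Qed.

Lemma unbounded_in_range (E : set int) (z : R) : unbounded_exponents E -> in_range E z.
Proof.
move=> hE; have [->|z0] := eqVneq z 0; [by left|right].
have z_gt0 : 0 < `|z| by rewrite normr_gt0.
by have /andP[h1 h2] := floor_log2 z_gt0; exists (Num.floor (log2 `|z|)).
Qed.

End Logarithms.

(** The exponent comparisons behind $Q^{7n+7} \le C^N$: the first is for the powers of $U^2$, the
    second for $64^{n(7n+7)} \le 2^{18N}$. *)
Lemma cst_N_ge n : (0 < n)%N ->
  (7 * n + 7 <= cst_N n)%N /\ (6 * n * (7 * n + 7) <= 18 * cst_N n)%N.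
Proof.
case: n => // n _; rewrite /cst_N.
(* Removes the truncated subtraction. *)
have -> : (2 * n.+1 ^ 3 + 13 * n.+1 ^ 2 - n.+1 = 2 * n.+1 ^ 3 + 13 * n * n.+1 + 12 * n.+1)%N.
  by rewrite !expnS expn0; nia.
by rewrite !expnS expn0; split; nia.
Qed.

Section Precision.
Context (R : realType) (n : nat) (A : 'M[R]_n) (b x0 : 'cV[R]_n) (eps : R).
Hypothesis Asym : A^T = A.
Hypothesis Apos : posdefmx A.
Hypothesis b_neq0 : b != 0.
Hypothesis e0_bnd : 0 < eps0 eps <= 1.

Notation U := (cst_U A b x0 eps).
Notation C := (cst_C A b x0 eps).
Notation V := (cst_V A b x0).
Notation Cs := (cst_Cs A b x0).
Notation d := (cst_d A eps).
Notation delta := (cst_delta A eps).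

(** From $d \le 1/200$: $8/d^2 \ge 320000 > 2^{18}$. *)
Lemma cst_C_ge : 2 ^+ 18 * U ^+ 2 <= C.
Proof.
have d0 := cst_d_gt0 Asym Apos b_neq0 e0_bnd.
have d1 := cst_d_lt1 Asym Apos b_neq0 e0_bnd.
rewrite /cst_C ler_pdivlMr ?exprn_gt0 // mulrAC ler_wpM2r ?sqr_ge0 //.
have h : d * d <= (1 / 200) * (1 / 200) by rewrite ler_pM // ltW.
by rewrite !exprS expr0; lra.
Qed.

Lemma cst_C_ge1 : 1 <= C.
Proof.
apply: le_trans cst_C_ge; have U2 := cst_U_ge2 x0 Asym Apos b_neq0 e0_bnd.
by apply: mulr_ege1; apply: exprn_ege1; lra.
Qed.

Lemma growth_pow_le : growth n U ^+ (7 * n + 7) <= C ^+ cst_N n.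
Proof.
have U2 := cst_U_ge2 x0 Asym Apos b_neq0 e0_bnd; have [N1 N2] := cst_N_ge (cV_neq0_dim b_neq0).
have UU : 1 <= U ^+ 2 by apply: exprn_ege1; lra.
have h : (2 ^+ 18 * U ^+ 2) ^+ cst_N n <= C ^+ cst_N n.
  apply: lerXn2r; rewrite ?nnegrE ?cst_C_ge //.
    by rewrite mulr_ge0 ?sqr_ge0 // exprn_ge0.
  by have := cst_C_ge1; lra.
apply: (le_trans _ h); rewrite /growth [X in X <= _]exprMn [X in _ <= X]exprMn.
have -> : (64 : R) = 2 ^+ 6 by rewrite !exprS expr0; ring.
by rewrite -!exprM ler_pM ?exprn_ge0 // ?ler_weXn2l ?leq_mul2l //; lra.
Qed.

Lemma cst_delta_gt0 : 0 < delta.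
Proof.
have d0 := cst_d_gt0 Asym Apos b_neq0 e0_bnd; have /andP[e0 _] := e0_bnd.
rewrite !lt_min ltr01 divr_gt0 //= divr_gt0 // mulr_gt0 // sqrtr_gt0.
by rewrite ltr0n (cV_neq0_dim b_neq0).
Qed.

Lemma cst_V_ge1 : 1 <= V.
Proof.
have k1 := kappa_ge1 Asym Apos b_neq0; have c1 := chi_ge1 A b x0.
rewrite /cst_V; have h : 0 <= cst_X A b x0.
  by rewrite /cst_X addr_ge0 // mulr_ge0 //; lra.
have : 1 <= (2 + cst_X A b x0) ^+ 2 by apply: exprn_ege1; lra.
by lra.
Qed.

Lemma cst_Cs_ge1 : 1 <= Cs.
Proof.
have h : 1 <= V ^+ 2 by apply: exprn_ege1; exact: cst_V_ge1.
by rewrite /cst_Cs; lra.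
Qed.

Lemma p_suff_bounds (p : nat) : p_suff A b x0 eps <= p%:Z ->
  2 * unit_roundoff R p * C ^+ cst_N n <= delta /\
  cst_Es A b x0 (unit_roundoff R p) 0 <= eps0 eps ^+ 2 / 256.
Proof.
rewrite /p_suff ceil_le_int ge_max => /andP[].
have C1 := cst_C_ge1; have V1 := cst_V_ge1; have Cs1 := cst_Cs_ge1.
have d0 := cst_delta_gt0; have /andP[e0 _] := e0_bnd.
have CN : 0 < C ^+ cst_N n by rewrite exprn_gt0 //; lra.
have CsN : 0 < Cs ^+ cst_Ns n by rewrite exprn_gt0 //; lra.
have VV : 0 < (V + 1) ^+ 2 by rewrite exprn_gt0 //; lra.
have pE : (p%:Z)%:~R = log2 (2 ^+ p : R) by rewrite -log2_exprz.
have p0 : 0 < (2 : R) ^+ p by rewrite exprn_gt0.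
have e2 : 0 < eps0 eps ^+ 2 by rewrite exprn_gt0.
have C0 : 0 < C by lra.
rewrite pE -log2X // -log2M ?divr_gt0 // => h1 h2.
have {}h1 : 2 / delta * C ^+ cst_N n <= 2 ^+ p.
  by rewrite -log2_le // mulr_gt0 // divr_gt0.
have {}h2 : 1024 * (V + 1) ^+ 2 * Cs ^+ cst_Ns n / eps0 eps ^+ 2 <= 2 ^+ p.
  have c0 : (0 : R) < 1024 by rewrite ltr0n.
  have h3 := mulr_gt0 (mulr_gt0 c0 VV) CsN.
  have h4 := divr_gt0 h3 e2.
  by move: h2; rewrite (log2_le h4 p0).
split.
  rewrite /unit_roundoff -mulrA mulrC -mulrA ler_pdivrMl //.
  by move: h1; rewrite mulrAC ler_pdivrMr //; lra.
rewrite /cst_Es /cst_rhos addr0 /unit_roundoff.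
move: h2; rewrite ler_pdivrMr // => h2.
(* The coefficient 4 here explains $1024 = 4 \cdot 256$ in [p_suff]. *)
have -> : 2 * (2 * 2 ^- p * (V + 1) ^+ 2) * Cs ^+ cst_Ns n
    = 2 ^- p * (4 * (V + 1) ^+ 2 * Cs ^+ cst_Ns n) by ring.
by rewrite ler_pdivrMl //; lra.
Qed.

End Precision.

Lemma cst_N_le n : (0 < n)%N ->
  (12 + cst_N n * 48 <= 999 * n ^ 3)%N /\ (29 + cst_Ns n * 18 <= 999 * n ^ 3)%N.
Proof.
move=> n0; rewrite /cst_N /cst_Ns.
have h0 := leq_subr n (2 * n ^ 3 + 13 * n ^ 2).
have h1 : (n ^ 2 <= n ^ 3)%N by rewrite leq_pexp2l.
have h2 : (n ^ 1 <= n ^ 3)%N by rewrite leq_pexp2l.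
have h3 : (0 < n ^ 3)%N by rewrite expn_gt0 n0.
rewrite expn1 in h2.
move: (n ^ 3)%N (n ^ 2)%N h0 h1 h2 h3 => n3 n2 h0 h1 h2 h3.
by split; lia.
Qed.

(** * Growth of the sufficient precision *)

Section Asymptotics.
Context (R : realType) (n : nat) (A : 'M[R]_n) (b : 'cV[R]_n) (eps : R).
Hypothesis Asym : A^T = A.
Hypothesis Apos : posdefmx A.
Hypothesis b_neq0 : b != 0.
Hypothesis eps_bnd : 0 < eps <= 1.

Notation y := (2 + n%:R * kappa2 A / eps).
Notation U := (cst_U A b 0 eps).
Notation C := (cst_C A b 0 eps).
Notation V := (cst_V A b 0).
Notation Cs := (cst_Cs A b 0).

Lemma cst_chi0 : cst_chi A b 0 = 1.
Proof.
by rewrite /cst_chi mulmx0 subr0 divff ?maxxx // norm2_eq0.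
Qed.

Lemma eps0_itv : 0 < eps0 eps <= 1.
Proof.
have /andP[e0 e1] := eps_bnd; have [-> h _] := eps0_bounds e0.
exact: le_trans h e1.
Qed.

Lemma scale_bounds : [/\ 3 <= y, n%:R <= y, kappa2 A <= y & (eps0 eps)^-1 <= 2 * y].
Proof.
have /andP[e0 e1] := eps_bnd; have [f0 f1 f2] := eps0_bounds e0.
have k1 := kappa_ge1 Asym Apos b_neq0.
have n1 : (1 : R) <= n%:R by rewrite ler1n (cV_neq0_dim b_neq0).
have i1 : 1 <= eps^-1 by rewrite invf_ge1.
have nk1 : n%:R <= n%:R * kappa2 A by rewrite ler_peMr //; lra.
have nk2 : kappa2 A <= n%:R * kappa2 A by rewrite ler_peMl //; lra.
have nk3 : n%:R * kappa2 A <= n%:R * kappa2 A / eps by rewrite ler_peMr //; lra.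
have nk4 : eps^-1 <= n%:R * kappa2 A / eps by rewrite ler_peMl //; lra.
split; try lra.
have : (eps0 eps)^-1 <= (eps / 2)^-1 by rewrite lef_pV2 ?posrE; lra.
by rewrite invf_div; lra.
Qed.

Lemma scale_pow_mono i j : (i <= j)%N -> y ^+ i <= y ^+ j.
Proof. by have [y3 _ _ _] := scale_bounds => ij; rewrite ler_weXn2l //; lra. Qed.

(** Since $y \ge 3$, numerical constants can be traded for powers of $y$. Every constant is thus
    bounded by a pure power of $y$, and its logarithm by a multiple of $\log_2 y$. *)
Lemma absorb_const (c : R) i j k : 0 <= c <= 3 ^+ i -> (i + j <= k)%N -> c * y ^+ j <= y ^+ k.
Proof.
have [y3 _ _ _] := scale_bounds => /andP[c0 c1] ijk.
apply: (le_trans _ (scale_pow_mono ijk)); rewrite exprD ler_wpM2r ?exprn_ge0 //.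
  by lra.
by apply: (le_trans c1); rewrite lerXn2r ?nnegrE //; lra.
Qed.

Lemma cst_dV_le : (cst_d A eps)^-1 <= y ^+ 10.
Proof.
have [y3 ny ky ey] := scale_bounds; have k1 := kappa_ge1 Asym Apos b_neq0.
have /andP[f0 _] := eps0_itv.
have ee : 0 < (eps0 eps)^-1 by rewrite invr_gt0.
have -> : (cst_d A eps)^-1 = 200 * (kappa2 A * (eps0 eps)^-1 ^+ 2).
  by rewrite /cst_d invf_div exprVn mulrA.
have h : kappa2 A * (eps0 eps)^-1 ^+ 2 <= y * (2 * y) ^+ 2.
  rewrite ler_pM //; [lra|exact: sqr_ge0|].
  by rewrite ler_sqr ?nnegrE //; lra.
apply: (@le_trans _ _ (800 * y ^+ 3)).
  by rewrite (_ : 800 * y ^+ 3 = 200 * (y * (2 * y) ^+ 2)); [rewrite ler_wpM2l|ring].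
apply: (@absorb_const _ 7) => //; rewrite !exprS expr0; lra.
Qed.

Lemma cst_U_le : U <= y ^+ 13.
Proof.
have [y3 ny ky ey] := scale_bounds; have k1 := kappa_ge1 Asym Apos b_neq0.
have dV := cst_dV_le.
have y1 : y <= y ^+ 10 by rewrite -[X in X <= _]expr1 scale_pow_mono.
have kk : kappa2 A ^+ 2 <= y ^+ 10.
  by apply: (@le_trans _ _ (y ^+ 2)); [rewrite ler_sqr ?nnegrE; lra|exact: scale_pow_mono].
apply: (@le_trans _ _ (13 * y ^+ 10)); last first.
  by apply: (@absorb_const _ 3) => //; rewrite !exprS expr0; lra.
rewrite /cst_U /cst_P /cst_G cst_chi0 !mulr1 expr1n mulr1.
rewrite (_ : (2 * kappa2 A + kappa2 A + 2) * kappa2 A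
  = 3 * kappa2 A ^+ 2 + 2 * kappa2 A); last by ring.
by lra.
Qed.

Lemma cst_U_ge0 : 0 <= U.
Proof. by have := cst_U_ge2 0 Asym Apos b_neq0 eps0_itv; lra. Qed.

Lemma cst_dV_ge0 : 0 <= (cst_d A eps)^-1.
Proof. by rewrite invr_ge0 ltW // (cst_d_gt0 Asym Apos b_neq0 eps0_itv). Qed.

Lemma scale_ge0 : 0 <= y.
Proof. by have [y3 _ _ _] := scale_bounds; lra. Qed.

Lemma cst_C_le : C <= y ^+ 48.
Proof.
rewrite /cst_C -exprVn -mulrA; apply: (@le_trans _ _ (8 * y ^+ 46)); last first.
  by apply: (@absorb_const _ 2) => //; rewrite !exprS expr0; lra.
rewrite (_ : 46 = 13 * 2 + 10 * 2)%N // exprD !exprM.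
have p13 := exprn_ge0 13 scale_ge0; have p10 := exprn_ge0 10 scale_ge0.
have hU : U ^+ 2 <= (y ^+ 13) ^+ 2.
  by rewrite lerXn2r ?nnegrE ?cst_U_ge0 // cst_U_le.
have hd : (cst_d A eps)^-1 ^+ 2 <= (y ^+ 10) ^+ 2.
  by rewrite lerXn2r ?nnegrE ?cst_dV_ge0 // cst_dV_le.
by rewrite ler_wpM2l // ler_pM // sqr_ge0.
Qed.

Lemma cst_deltaV_le : 2 / cst_delta A eps <= y ^+ 12.
Proof.
have [y3 ny ky ey] := scale_bounds; have /andP[f0 f1] := eps0_itv.
have d0 := cst_d_gt0 Asym Apos b_neq0 eps0_itv; have dV0 := cst_dV_le.
have delta0 := cst_delta_gt0 Asym Apos b_neq0 eps0_itv.
have n0 := cV_neq0_dim b_neq0.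
have n1 : (1 : R) <= n%:R by rewrite ler1n.
have y11 : 0 < y ^+ 11 by rewrite exprn_gt0 //; lra.
have key : (y ^+ 11)^-1 <= cst_delta A eps.
  rewrite /cst_delta !le_min; apply/and3P; split.
  - by rewrite invf_le1 // exprn_ege1 //; lra.
  - have d2 : 0 < cst_d A eps / 2 by rewrite divr_gt0.
    rewrite -[cst_d A eps / 2]invrK lef_pV2 ?posrE ?invr_gt0 //.
    rewrite invf_div; apply: (@le_trans _ _ (2 * y ^+ 10)).
      by rewrite ler_wpM2l.
    by apply: (@absorb_const _ 1) => //; rewrite expr1; lra.
  - have s0 : 0 < Num.sqrt n%:R :> R by rewrite sqrtr_gt0 ltr0n.
    have sn : Num.sqrt n%:R <= n%:R :> R.
      rewrite -[X in _ <= X]ger0_norm // -sqrtr_sqr ler_wsqrtr //.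
      by rewrite expr2 ler_peMl.
    have c20 : 0 < 20 * Num.sqrt n%:R :> R by rewrite mulr_gt0.
    have q0 := divr_gt0 f0 c20.
    rewrite -[eps0 eps / _]invrK lef_pV2 ?posrE ?invr_gt0 //.
    rewrite invf_div; apply: (@le_trans _ _ (40 * y ^+ 2)).
      rewrite (_ : 40 * y ^+ 2 = 20 * y * (2 * y)); last by ring.
      have i0 : 0 <= (eps0 eps)^-1 by rewrite invr_ge0 ltW.
      have h20 : 20 * Num.sqrt n%:R <= 20 * y by rewrite ler_wpM2l //; lra.
      exact: ler_pM (ltW c20) i0 h20 ey.
    by apply: (@absorb_const _ 4) => //; rewrite !exprS expr0; lra.
apply: (@le_trans _ _ (2 * y ^+ 11)).
  rewrite ler_wpM2l // -[leRHS]invrK lef_pV2 ?posrE ?invr_gt0 //.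
by apply: (@absorb_const _ 1) => //; rewrite expr1; lra.
Qed.

Lemma cst_V_le : V <= y ^+ 8.
Proof.
have [y3 ny ky ey] := scale_bounds; have k1 := kappa_ge1 Asym Apos b_neq0.
rewrite /cst_V /cst_X cst_chi0; apply: (@le_trans _ _ (4 * (y ^+ 3) ^+ 2)).
  rewrite ler_wpM2l // lerXn2r ?nnegrE ?exprn_ge0 ?scale_ge0 //; first by lra.
  apply: (@le_trans _ _ (7 * y ^+ 1)); first by rewrite expr1; lra.
  by apply: (@absorb_const _ 2) => //; rewrite !exprS expr0; lra.
rewrite -exprM; apply: (@absorb_const _ 2) => //; rewrite !exprS expr0; lra.
Qed.

Lemma cst_Cs_le : Cs <= y ^+ 18.
Proof.
have V1 := cst_V_ge1 0 Asym Apos b_neq0.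
rewrite /cst_Cs; apply: (@le_trans _ _ (8 * (y ^+ 8) ^+ 2)).
  by rewrite ler_wpM2l // lerXn2r ?nnegrE ?exprn_ge0 ?scale_ge0 ?cst_V_le //; lra.
by rewrite -exprM; apply: (@absorb_const _ 2) => //; rewrite !exprS expr0; lra.
Qed.

Lemma cst_Cs_term_le :
  1024 * (V + 1) ^+ 2 * Cs ^+ cst_Ns n / eps0 eps ^+ 2 <= y ^+ (29 + cst_Ns n * 18).
Proof.
have V1 := cst_V_ge1 0 Asym Apos b_neq0.
have Cs1 := cst_Cs_ge1 0 Asym Apos b_neq0.
have [y3 ny ky ey] := scale_bounds; have /andP[f0 f1] := eps0_itv.
have VV : (V + 1) ^+ 2 <= y ^+ 18.
  rewrite (_ : 18 = 9 * 2)%N // exprM lerXn2r ?nnegrE ?exprn_ge0 ?scale_ge0 //; first lra.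
  apply: (@le_trans _ _ (2 * y ^+ 8)); first by have := cst_V_le; lra.
  by apply: (@absorb_const _ 1) => //; rewrite expr1; lra.
have CC : Cs ^+ cst_Ns n <= y ^+ (cst_Ns n * 18).
  by rewrite mulnC exprM lerXn2r ?nnegrE ?exprn_ge0 ?scale_ge0 ?cst_Cs_le //; lra.
have ee : (eps0 eps ^+ 2)^-1 <= y ^+ 4.
  rewrite -exprVn; apply: (@le_trans _ _ ((2 * y) ^+ 2)).
    by rewrite lerXn2r ?nnegrE ?invr_ge0 ?mulr_ge0 ?scale_ge0 ?(ltW f0).
  by rewrite exprMn; apply: (@absorb_const _ 2) => //; rewrite !exprS expr0; lra.
have c7 : (1024 : R) <= y ^+ 7.
  have := @absorb_const 1024 7 0 7; rewrite expr0 mulr1; apply=> //.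
  by rewrite !exprS expr0; lra.
rewrite (_ : 29 + cst_Ns n * 18 = 7 + 18 + cst_Ns n * 18 + 4)%N; last by rewrite addnAC.
rewrite !(exprD y).
have g1 : 0 <= (V + 1) ^+ 2 := sqr_ge0 _.
have g2 : 0 <= Cs ^+ cst_Ns n by rewrite exprn_ge0 //; lra.
have g3 : 0 <= (eps0 eps ^+ 2)^-1 by rewrite invr_ge0 sqr_ge0.
have g4 : (0 : R) <= 1024 := ler0n _ _.
have h1 := ler_pM (mulr_ge0 g4 g1) g2 (ler_pM g4 g1 c7 VV) CC.
exact: (ler_pM (mulr_ge0 (mulr_ge0 g4 g1) g2) g3 h1 ee).
Qed.

Lemma p_suff_le :
  `|(p_suff A b 0 eps)%:~R| <= (1000 / ln 2) * n%:R ^+ 3 * ln y.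
Proof.
have [y3 ny ky ey] := scale_bounds; have /andP[f0 f1] := eps0_itv.
have l2 := ln2_gt0 R.
have C1 := cst_C_ge1 0 Asym Apos b_neq0 eps0_itv.
have V1 := cst_V_ge1 0 Asym Apos b_neq0; have Cs1 := cst_Cs_ge1 0 Asym Apos b_neq0.
have delta0 := cst_delta_gt0 Asym Apos b_neq0 eps0_itv.
have [N1 N2] := cst_N_le (cV_neq0_dim b_neq0).
have y0 : 0 < y by lra.
have ly : 1 <= log2 y.
  have log22 : log2 2 = 1 :> R by rewrite /log2 divff // gt_eqF.
  have : log2 2 <= log2 y by rewrite log2_le //; lra.
  by rewrite log22.
rewrite /p_suff; set m := Num.max _ _.
have C0 : 0 < C by lra.
(* This removes the absolute value around the ceiling. *)
have m_ge0 : 0 <= m.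
  rewrite le_max; apply/orP; left; apply: addr_ge0.
    apply: log2_ge0; rewrite ler_pdivlMr // mul1r.
    have : cst_delta A eps <= 1 by rewrite /cst_delta ge_min lexx.
    by lra.
  by rewrite mulr_ge0 // log2_ge0.
have m_le : m <= (999 * n ^ 3)%:R * log2 y.
  have aux k : (k <= 999 * n ^ 3)%N -> k%:R * log2 y <= (999 * n ^ 3)%:R * log2 y.
    by move=> h; rewrite ler_wpM2r ?ler_nat //; lra.
  rewrite ge_max; apply/andP; split.
    apply: le_trans (aux _ N1).
    rewrite (natrD _ 12) [X in _ <= X]mulrDl; apply: lerD.
      by apply: log2_le_pow cst_deltaV_le => //; rewrite divr_gt0.
    rewrite (natrM _ (cst_N n)) -mulrA ler_wpM2l //.
    exact: log2_le_pow cst_C_le.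
  apply: le_trans (aux _ N2).
  have c0 : (0 : R) < 1024 by rewrite ltr0n.
  have VV : 0 < (V + 1) ^+ 2 by rewrite exprn_gt0 //; lra.
  have CsN : 0 < Cs ^+ cst_Ns n by rewrite exprn_gt0 //; lra.
  have e2 : 0 < eps0 eps ^+ 2 by rewrite exprn_gt0.
  have t0 := divr_gt0 (mulr_gt0 (mulr_gt0 c0 VV) CsN) e2.
  exact: (log2_le_pow t0 y0 cst_Cs_term_le).
have ceil0 : 0 <= (Num.ceil m)%:~R :> R by apply: le_trans m_ge0 (ceil_ge m).
rewrite ger0_norm //.
have := ceilB1_lt m; rewrite intrD mulrN1z => hceil.
have n3 : (1 : R) <= (n ^ 3)%:R by rewrite ler1n expn_gt0 (cV_neq0_dim b_neq0).
have -> : 1000 / ln 2 * n%:R ^+ 3 * ln y = 1000 * ((n ^ 3)%:R * log2 y).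
  by rewrite /log2 natrX; ring.
rewrite (natrM _ 999) -mulrA in m_le.
(* The ceiling adds less than 1, which the step from 999 to 1000 absorbs. *)
have h1 : 1 <= (n ^ 3)%:R * log2 y := mulr_ege1 n3 ly.
by lra.
Qed.

End Asymptotics.

Theorem corollary2 (R : realType) :
  exists K : R, 0 < K /\
  forall (n : nat) (A : 'M[R]_n) (b x0 : 'cV[R]_n) (eps : R)
         (p : nat) (E : set int) (fl : R -> R),
    A^T = A -> posdefmx A -> b != 0 ->
    2^-1 <= opnorm2 A <= 1 -> 2^-1 <= norm2 b <= 1 ->
    0 < eps <= 1 ->
    (0 < p)%N ->
    unbounded_exponents E ->
    round_to_nearest E p fl ->
    rounding_model E (unit_roundoff R p) 0 fl ->
    range_assumption E p A b x0 eps ->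
    (p_suff A b x0 eps <= p%:Z ->
       [/\ 2 * unit_roundoff R p * cst_C A b x0 eps ^+ cst_N n
             <= cst_delta A eps,
           cst_Es A b x0 (unit_roundoff R p) 0 <= eps0 eps ^+ 2 / 256 &
           forall s : nat -> cg_state R n,
             cg_execution fl A b x0 (eps0 eps) s ->
             exists (i : nat) (x r d : 'cV[R]_n),
               [/\ (i <= n)%N, s i = CGRun x r d, s i.+1 = CGReturn x, x != 0 &
                   [/\ eta A b x <= eta_A A b x, eta_A A b x <= eps0 eps &
                       eps0 eps <= eps]]])
    /\
    (x0 = 0 ->
       `|(p_suff A b x0 eps)%:~R|
         <= K * n%:R ^+ 3 * ln (2 + n%:R * kappa2 A / eps)).
Proof.
have c0 : (0 : R) < 1000 by rewrite ltr0n.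
exists (1000 / ln 2); split; first exact: divr_gt0 c0 (ln2_gt0 R).
move=> n A b x0 eps p E fl Asym Apos b0 A_bnd b_bnd eps_bnd _ hE _ flE _.
have e0_bnd := eps0_itv eps_bnd.
split; last by move=> ->; exact: p_suff_le.
move=> hp; have [h1 h2] := p_suff_bounds Asym Apos b0 e0_bnd hp.
have p0 : 0 < (2 : R) ^+ p by rewrite exprn_gt0.
have u_bnd : 0 <= unit_roundoff R p <= 1.
  by rewrite invr_ge0 (ltW p0) invf_le1 // exprn_ege1 // ler1n.
have flP z : `|fl z - z| <= unit_roundoff R p * `|z|.
  by have := flE z (unbounded_in_range z hE); rewrite addr0.
have u_small : growth n (cst_U A b x0 eps) ^+ (7 * n + 7) * unit_roundoff R p
    <= cst_d A eps / 4.
  have /andP[u0 _] := u_bnd.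
  have hG := ler_wpM2r u0 (growth_pow_le x0 Asym Apos b0 e0_bnd).
  (* With $2uC^N \le \delta$ this gives $uC^N \le d/4$. *)
  have hd : cst_delta A eps <= cst_d A eps / 2.
    by rewrite /cst_delta !ge_min lexx orbT.
  apply: (le_trans hG); lra.
split=> // s /(cg_execution_stops Asym Apos b0 A_bnd b_bnd e0_bnd u_bnd flP u_small).
move=> [i [z [rr [pp [i_le sE sSE hz]]]]]; exists i, z, rr, pp.
have [z0 e1 e2] := backward_error_bound b0 A_bnd e0_bnd hz.
split=> //; split=> //.
by have /andP[eps_gt0 _] := eps_bnd; have [] := eps0_bounds eps_gt0.
Qed.
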